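(* Let $q\in(-1,1)$, $k\ge1$, $\lambda_1,\dots,\lambda_k\ge1$ and $\mu_j=\lambda_j^{1/4}$. With the random operators $s_{n,j}=\frac1{\sqrt n}\sum_{i=1}^n\gamma_{i,j}$ and the operators $c_j$ ($1\le j\le k$) defined in the context, for all $p\ge1$, all $(j(1),\dots,j(p))\in\{1,\dots,k\}^p$ and all $(k(1),\dots,k(p))\in\{-1,1\}^p$ we have $$\lim_{n\to+\infty}\varphi^{\overline\epsilon}\big(s_{n,j(1)}^{k(1)}\cdots s_{n,j(p)}^{k(p)}\big)=\varphi\big(c_{j(1)}^{k(1)}\cdots c_{j(p)}^{k(p)}\big)\quad\text{almost surely},$$ where by convention $x^{-1}$ denotes the adjoint $x^*$.
   Context: Random signs: $(\epsilon(i,i'))_{i\ne i'\in\mathbb N_*}$ ($\mathbb N_*=\{1,2,\dots\}$) are random variables with $\epsilon(i,i')=\epsilon(i',i)$, with $(\epsilon(i,i'))_{i>i'}$ independent, each of law $\frac{1+q}2\delta_1+\frac{1-q}2\delta_{-1}$; set $\epsilon(i,i)=-1$. Let $\overline I=\mathbb N_*\times(\{-k,\dots,-1\}\cup\{1,\dots,k\})$ and $\overline\epsilon((i,j),(i',j'))=\epsilon(i,i')$. Let $\mathcal A(\overline I,\overline\epsilon)$ be the complex unital $*$-algebra generated by self-adjoint $x_{u}$, $u\in\overline I$, with relations $x_ux_v-\overline\epsilon(u,v)x_vx_u=2\delta_{u,v}$. Fix a total order on $\overline I$; for a finite subset $B=\{u_1<\dots<u_m\}$ put $x_B=x_{u_1}\cdots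 x_{u_m}$, $x_\emptyset=1$; these form a linear basis. Let $\varphi^{\overline\epsilon}(x_B)=\delta_{B,\emptyset}$, and let $L^2$ be the completion of $\mathcal A(\overline I,\overline\epsilon)$ for $\langle x,y\rangle=\varphi^{\overline\epsilon}(x^*y)$, for which $(x_B)$ is an orthonormal basis. For $u\in\overline I$ let $\beta_u^*$ be the partial isometry of $L^2$ with $\beta_u^*(x_B)=x_ux_B$ if $u\notin B$ and $0$ if $u\in B$; $\beta_u$ is its adjoint. (Nothing depends on the chosen order.) Also write $\varphi^{\overline\epsilon}(T)=\langle 1,T1\rangle$ for $T\in B(L^2)$. For $i\in\mathbb N_*$, $1\le j\le k$: $\gamma_{i,j}=\mu_j^{-1}\beta_{i,j}^*+\mu_j\beta_{i,-j}$. $q$-Fock side: let $(e_j)_{j\in\{-k,\dots,-1\}\cup\{1,\dots,k\}}$ be the canonical orthonormal basis of $\mathbb C^{2k}$. $\mathcal F_q(\mathbb C^{2k})=\mathbb C\Omega\oplus\bigoplus_{n\ge1}(\mathbb C^{2k})^{\otimes n}$ is completed for $\langle h_1\otimes\dots\otimes h_n,g_1\otimes\dots\otimes g_m\rangle_q=\delta_{n,m}\sum_{\pi\in S_n}q^{\mathrm{inv}(\pi)}\prod_i\langle h_i,g_{\pi(i)}\rangle$ ($\mathrm{inv}$ = number of inversions). $a^*(h)$ is the creation operator $a^*(h)\Omega=h$, $a^*(h)(h_1\otimes\dots\otimes h_n)=h\otimes h_1\otimes\dots\otimes h_n$, and $a(h)$ its adjoint. $c_j=\mu_ja(e_{-j})+\mu_j^{-1}a^*(e_j)$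 for $1\le j\le k$, and $\varphi(T)=\langle\Omega,T\Omega\rangle$ is the vacuum state. *)

(* Defs.v *)
From HB Require Import structures.
From mathcomp Require Import all_boot all_order all_fingroup all_algebra.
From mathcomp Require Import finmap.
From mathcomp Require Import all_classical all_reals all_analysis.
From mathcomp Require Import complex.

Set Implicit Arguments.
Unset Strict Implicit.
Unset Printing Implicit Defensive.

Import Order.TTheory GRing.Theory Num.Theory.
Import numFieldNormedType.Exports.

Local Open Scope classical_set_scope.
Local Open Scope ring_scope.
Local Open Scope complex_scope.

(** * Complex Hilbert spaces *)

Record hilbertType (R : realType) := Hilbert {
  hcarrier :> completeNormedModType R[i] ;
  hdot : {dot hcarrier for (@Num.conj R[i])} ;
  hdotE : forall x : hcarrier, `|x| ^+ 2 = hdot x x }.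

(* MathComp's [{dot _ for _}] is linear in its first argument; the inner
   products below are linear in the second one. *)
Definition inner (R : realType) (H : hilbertType R) (x y : H) : R[i] :=
  hdot H y x.

Definition is_adjoint (R : realType) (H : hilbertType R) (T S : H -> H) :=
  forall x y : H, inner (S x) y = inner x (T y).

(* Everywhere defined adjoints are unique, so the choice is immaterial as soon
   as an adjoint exists, in particular when [T] is bounded. *)
Definition adjoint (R : realType) (H : hilbertType R) (T : H -> H) : H -> H :=
  xget (fun=> 0) [set S | is_adjoint T S].

(* [true] stands for the exponent 1 and [false] for the exponent -1, that is,
   for the adjoint. *)
Definition signed_power (R : realType) (H : hilbertType R) (T : H -> H)
  (e : bool) : H -> H := if e then T else adjoint T.

Definition vector_state (R : realType) (H : hilbertType R) (x : H)
  (T : H -> H) : R[i] := inner x (T x).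

(* T_0 \o T_1 \o ... \o T_(p-1) *)
Definition op_prod (H : Type) (p : nat) (T : 'I_p -> H -> H) : H -> H :=
  \big[(fun S S' : H -> H => S \o S') / id]_(m < p) T m.

(** * The index sets *)

(* {-k, ..., -1} U {1, ..., k}: (j, true) stands for j + 1 and (j, false)
   for -(j + 1). *)
Definition signed_index (k : nat) := ('I_k * bool)%type.

(* Positive integers are represented by their predecessors. *)
Definition gen_index (k : nat) := (nat * signed_index k)%type.

Definition is_total_order (I : eqType) (r : rel I) :=
  [/\ total r, transitive r & antisymmetric r].

(** * The *-algebra with generators x_u and its GNS space *)

Definition is_star (R : realType) (A : algType R[i]) (star : A -> A) :=
  [/\ forall (c : R[i]) (a b : A), star (c *: a + b) = c^* *: star a + star b,
      forall a b : A, star (a * b) = star b * star a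
    & involutive star].

Definition sign_relations (R : realType) (I : eqType) (sg : I -> I -> R[i])
    (A : algType R[i]) (star : A -> A) (x : I -> A) :=
  (forall u, star (x u) = x u) /\
  (forall u v, x u * x v - sg u v *: (x v * x u) = 2 *+ (u == v)).

(* Unital *-algebra presented by self-adjoint generators and the relations:
   it is generated by the [sgen u], and any other solution of the relations is
   the image of [sgen] under a unital *-homomorphism. *)
Record sign_algebra (R : realType) (I : eqType) (sg : I -> I -> R[i]) :=
  SignAlgebra {
    salg :> algType R[i] ;
    sstar : salg -> salg ;
    sgen : I -> salg ;
    sstarP : is_star sstar ;
    sgenP : sign_relations sg sstar sgen ;
    sgen_generates : forall S : set salg,
      (forall u, S (sgen u)) -> S 1 ->
      (forall (c : R[i]) a b, S a -> S b -> S (c *: a + b)) ->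
      (forall a b, S a -> S b -> S (a * b)) ->
      (forall a, S a -> S (sstar a)) ->
      forall a, S a ;
    sgen_universal : forall (B : algType R[i]) (star : B -> B) (y : I -> B),
      is_star star -> sign_relations sg star y ->
      exists f : {lrmorphism salg -> B},
        (forall u, f (sgen u) = y u) /\ (forall a, f (sstar a) = star (f a)) }.

Definition monomial (R : realType) (I : choiceType) (sg : I -> I -> R[i])
    (A : sign_algebra sg) (r : rel I) (B : {fset I}) : A :=
  \prod_(u <- sort r B) sgen A u.

(* [gns] is the completion of [galg] for <a, b> = gphi (a^* b), with
   canonical embedding [gincl]; [gcre u] and [gann u] are beta_u^* and beta_u.
   All these data are determined by [sg] up to isomorphism. *)
Record sign_space (R : realType) (I : choiceType) (r : rel I)
    (sg : I -> I -> R[i]) := SignSpace {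
  galg : sign_algebra sg ;
  gphi : {linear galg -> R[i]^o} ;
  gphiE : forall B : {fset I}, gphi (monomial galg r B) = (B == fset0)%:R ;
  gns :> hilbertType R ;
  gincl : {linear galg -> gns} ;
  gincl_inner : forall a b : galg,
    inner (gincl a) (gincl b) = gphi (sstar a * b) ;
  gincl_dense : dense (range gincl) ;
  gcre : I -> {linear gns -> gns} ;
  gcre_continuous : forall u, continuous (gcre u) ;
  gcreE : forall (u : I) (B : {fset I}),
    gcre u (gincl (monomial galg r B)) =
      if u \in B then 0 else gincl (sgen galg u * monomial galg r B) ;
  gann : I -> {linear gns -> gns} ;
  gannE : forall u, is_adjoint (gcre u) (gann u) }.

Definition gvac (R : realType) (I : choiceType) (r : rel I)
  (sg : I -> I -> R[i]) (M : sign_space r sg) : M := gincl M 1.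

(* gamma_(i,j) and s_(n,j), for the weights [mu] *)
Definition gamma_op (R : realType) (k : nat) (r : rel (gen_index k))
    (sg : gen_index k -> gen_index k -> R[i]) (M : sign_space r sg) (mu : 'I_k -> R)
    (i : nat) (j : 'I_k) (x : M) : M :=
  (mu j)^-1%:C *: gcre M (i, (j, true)) x +
  (mu j)%:C *: gann M (i, (j, false)) x.

Definition s_op (R : realType) (k : nat) (r : rel (gen_index k))
    (sg : gen_index k -> gen_index k -> R[i]) (M : sign_space r sg) (mu : 'I_k -> R)
    (n : nat) (j : 'I_k) (x : M) : M :=
  (Num.sqrt n%:R)^-1%:C *: \sum_(i < n) gamma_op mu i j x.

(** * Random signs *)

(* Independence of the subfamily of [X] indexed by [D] *)
Definition independent_on d (T : measurableType d) (R : realType)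
    (P : probability T R) (I : choiceType) (D : set I)
    (X : I -> {RV P >-> R}) :=
  forall (J : {fset I}) (B : I -> set R),
    (forall i, i \in J -> D i) -> (forall i, measurable (B i)) ->
    P (\bigcap_(i in [set` J]) X i @^-1` B i) =
    (\prod_(i <- J) P (X i @^-1` B i))%E.

(* Only the entries of [eps] off the diagonal are relevant. *)
Definition random_signs d (T : measurableType d) (R : realType)
    (P : probability T R) (q : R) (eps : nat -> nat -> {RV P >-> R}) :=
  [/\ forall i i' w, i != i' -> eps i i' w = eps i' i w,
      forall i i', (i' < i)%N -> forall B, measurable B ->
        distribution P (eps i i') B =
        (((1 + q) / 2)%R%:E * \d_(1%R : R) B +
         ((1 - q) / 2)%R%:E * \d_((- 1)%R : R) B)%E
    & independent_on [set ii : nat * nat | (ii.2 < ii.1)%N]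
        (fun ii => eps ii.1 ii.2)].

Definition sign_matrix (T : Type) (R : realType) (eps : nat -> nat -> T -> R)
    (k : nat) (w : T) (u v : gen_index k) : R[i] :=
  if u.1 == v.1 then -1 else (eps u.1 v.1 w)%:C.

(** * The q-Fock space over C^(2k) *)

Definition one_particle (R : realType) (k : nat) :=
  {ffun signed_index k -> R[i]^o}.

Definition basis_vector (R : realType) (k : nat) (j : signed_index k) :
  one_particle R k := [ffun j' => (j' == j)%:R].

Definition one_particle_inner (R : realType) (k : nat)
  (h g : one_particle R k) : R[i] := \sum_j (h j)^* * g j.

(* The n-th tensor power of C^(2k), in coordinates with respect to the
   elementary tensors of basis vectors *)
Definition tensor_power (R : realType) (k n : nat) :=
  {ffun n.-tuple (signed_index k) -> R[i]^o}.

Definition elementary_tensor (R : realType) (k n : nat)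
    (h : n.-tuple (one_particle R k)) : tensor_power R k n :=
  [ffun w => \prod_(i < n) tnth h i (tnth w i)].

Definition inversions (n : nat) (s : 'S_n) : nat :=
  #|[pred ij : 'I_n * 'I_n | (ij.1 < ij.2)%N && (s ij.2 < s ij.1)%N]|.

(* [fock] is the completion of the direct sum of the tensor powers, with
   canonical embeddings [fincl n]; [fcre h] and [fann h] are a^*(h) and a(h).
   All these data are determined by [q] and [k] up to isomorphism. *)
Record qfock_space (R : realType) (q : R) (k : nat) := QFockSpace {
  fock :> hilbertType R ;
  fincl : forall n, {linear tensor_power R k n -> fock} ;
  fincl_inner : forall n (h g : n.-tuple (one_particle R k)),
    inner (fincl n (elementary_tensor h)) (fincl n (elementary_tensor g)) =
    \sum_(s : 'S_n) (q ^+ inversions s)%:C *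
      \prod_(i < n) one_particle_inner (tnth h i) (tnth g (s i)) ;
  fincl_orthogonal : forall n m (h : n.-tuple (one_particle R k))
      (g : m.-tuple (one_particle R k)), n != m ->
    inner (fincl n (elementary_tensor h)) (fincl m (elementary_tensor g)) = 0 ;
  fincl_dense : dense [set x : fock | exists (N : nat)
    (t : forall n, tensor_power R k n), x = \sum_(n < N) fincl n (t n)] ;
  fcre : one_particle R k -> {linear fock -> fock} ;
  fcre_continuous : forall h, continuous (fcre h) ;
  fcreE : forall (h : one_particle R k) n (t : n.-tuple (one_particle R k)),
    fcre h (fincl n (elementary_tensor t)) =
    fincl n.+1 (elementary_tensor [tuple of h :: t]) ;
  fann : one_particle R k -> {linear fock -> fock} ;
  fannE : forall h, is_adjoint (fcre h) (fann h) }.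

Definition fvac (R : realType) (q : R) (k : nat) (F : qfock_space q k) : F :=
  fincl F 0 (elementary_tensor [tuple]).

(* c_j, for the weights [mu] *)
Definition c_op (R : realType) (q : R) (k : nat) (F : qfock_space q k)
    (mu : 'I_k -> R) (j : 'I_k) (x : F) : F :=
  (mu j)%:C *: fann F (basis_vector R (j, false)) x +
  (mu j)^-1%:C *: fcre F (basis_vector R (j, true)) x.

(* Main.v *)
(* Apply a word of operators s_(n,j), s_(n,j)^* to x_(i_1,g_1) ... x_(i_m,g_m)
   and take the vacuum expectation.  Averaged over the labels i_1, ..., i_m, and
   normalised by n^(m/2), this converges to the expectation of the corresponding
   word in the c_j, c_j^* applied to e_(g_1) (x) ... (x) e_(g_m); the theorem is
   the case m = 0.  The induction is on the length of the word.  A creation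
   operator lengthens the list exactly as on the Fock space.  An annihilation
   operator removes the l-th element of the list for some l, at the cost of the
   factor (1/n) sum_a prod_(v < l) eps(a, i_v), which should be q^l up to an error
   that is small on average over the labels.  It is, as soon as eps - q is small
   in the cut norm, and the cut norm is controlled by the number of 4-cycles,
   that is, by the trace of (eps - q)^4 (as for quasi-random graphs).  That trace
   is nondecreasing in n and its expectation is O(n^3), so that it is o(n^4)
   almost surely, first along the powers of 2 and then for all n. *)

From mathcomp Require Import finmap.
Require Import Defs.
From mathcomp Require Import all_boot all_order all_fingroup all_algebra.
From mathcomp Require Import all_classical all_reals all_analysis.
From mathcomp Require Import complex measurable_realfun.
From mathcomp Require Import ring lra zify.

Set Implicit Arguments.
Unset Strict Implicit.
Unset Printing Implicit Defensive.

Import Order.TTheory GRing.Theory Num.Theory.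
Import numFieldNormedType.Exports.

Local Open Scope classical_set_scope.
Local Open Scope ring_scope.
Local Open Scope complex_scope.

(** * Words and averages over labels *)

Section TupleSums.
Variables (R : realType) (C : eqType).
Implicit Types (n : nat) (g : seq C) (s : seq (nat * C)) (f : seq (nat * C) -> R).

(* The sum of [f] over all ways of attaching labels in {0, ..., n - 1} to the
   colours listed in [g] *)
Fixpoint label_sum n g f : R :=
  if g is c :: g' then
    \sum_(a < n) label_sum n g' (fun s => f ((nat_of_ord a, c) :: s))
  else f [::].

Definition labelling n g s := (map snd s == g) && all (fun u => (u.1 < n)%N) s.

Lemma eq_label_sum n g f f' :
  (forall s, labelling n g s -> f s = f' s) -> label_sum n g f = label_sum n g f'.
Proof.
elim: g f f' => [|c g IH] f f' h /=; first exact: h.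
apply: eq_bigr => a _; apply: IH => s lab; apply: h.
by case/andP: lab => /eqP <- sn; rewrite /labelling /= eqxx ltn_ord.
Qed.

Lemma ler_label_sum n g f f' :
  (forall s, labelling n g s -> f s <= f' s) -> label_sum n g f <= label_sum n g f'.
Proof.
elim: g f f' => [|c g IH] f f' h /=; first exact: h.
apply: ler_sum => a _; apply: IH => s lab; apply: h.
by case/andP: lab => /eqP <- sn; rewrite /labelling /= eqxx ltn_ord.
Qed.

Lemma label_sum_cat n g1 g2 f :
  label_sum n (g1 ++ g2) f =
  label_sum n g1 (fun s1 => label_sum n g2 (fun s2 => f (s1 ++ s2))).
Proof. by elim: g1 f => [//|c g1 IH] f /=; apply: eq_bigr => a _; rewrite IH. Qed.

Lemma label_sumD n g f f' :
  label_sum n g (fun s => f s + f' s) = label_sum n g f + label_sum n g f'.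
Proof.
elim: g f f' => [//|c g IH] f f' /=; rewrite -big_split /=.
by apply: eq_bigr => a _; rewrite IH.
Qed.

Lemma label_sumZ n g (x : R) f :
  label_sum n g (fun s => x * f s) = x * label_sum n g f.
Proof.
elim: g f => [//|c g IH] f /=; rewrite mulr_sumr.
by apply: eq_bigr => a _; rewrite IH.
Qed.

Lemma label_sum_sum n g m (f : 'I_m -> seq (nat * C) -> R) :
  label_sum n g (fun s => \sum_(i < m) f i s) = \sum_(i < m) label_sum n g (f i).
Proof.
elim: g f => [//|c g IH] f /=; rewrite exchange_big /=.
by apply: eq_bigr => a _; rewrite IH.
Qed.

Lemma label_sum_cst n g (x : R) :
  label_sum n g (fun=> x) = x * n%:R ^+ size g.
Proof.
elim: g => [|c g IH] /=.
  by rewrite mulr1.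
by rewrite IH sumr_const card_ord exprSr mulrA mulr_natr.
Qed.

Lemma ler_norm_label_sum n g f :
  `|label_sum n g f| <= label_sum n g (fun s => `|f s|).
Proof.
elim: g f => [//|c g IH] f /=.
by apply: le_trans (ler_norm_sum _ _ _) _; apply: ler_sum => a _; exact: IH.
Qed.

End TupleSums.

(** * Words of letters and their values in the two models *)

Section Words.
Variables (R : realType) (C : eqType).

(* The letter [Letter x c y c'] stands for the operator
   x * (creation of colour c) + y * (annihilation of colour c').  In a word the
   letter acting first comes first. *)
Record letter := Letter { lcre : R; lup : C; lann : R; ldown : C }.

Definition omit (T : Type) (l : nat) (s : seq T) := take l s ++ drop l.+1 s.

Lemma size_omit (T : Type) (l : nat) (s : seq T) :
  (l < size s)%N -> size (omit l s) = (size s).-1.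
Proof.
by move=> ls; rewrite size_cat size_take ls size_drop; lia.
Qed.

(** Weight with which the annihilators of colour [c] and labels below [n] together remove the [l]-th
    element: only the label [u.1] can contribute. *)
Definition annihilate (sg : nat -> nat -> R) n (c : C) s (l : nat) : R :=
  let u := nth (0%N, c) s l in
  if (u.2 == c) && (u.1 < n)%N then \prod_(v <- take l s) sg u.1 v.1 else 0.

(* Vacuum expectations of words in the two models: [inner_word_op] and
   [inner_fock_word_op] *)
Fixpoint sign_value (sg : nat -> nat -> R) n (W : seq letter) (s : seq (nat * C)) : R :=
  if W is L :: W' then
    lcre L * ((Num.sqrt n%:R)^-1 *
      \sum_(a < n) sign_value sg n W' ((nat_of_ord a, lup L) :: s)) +
    lann L * ((Num.sqrt n%:R)^-1 * (if uniq s then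
      \sum_(l < size s) annihilate sg n (ldown L) s l * sign_value sg n W' (omit l s)
      else 0))
  else (s == [::])%:R.

Fixpoint fock_value (q : R) (W : seq letter) (g : seq C) : R :=
  if W is L :: W' then
    lcre L * fock_value q W' (lup L :: g) +
    lann L * \sum_(l < size g)
      (if nth (ldown L) g l == ldown L then q ^+ l else 0) * fock_value q W' (omit l g)
  else (g == [::])%:R.

(** A creation keeps the repetition, and the annihilation term is guarded by [uniq]; this reflects
    that repeated generators stand for the zero vector. *)
Lemma sign_value_nuniq sg n W s : ~~ uniq s -> sign_value sg n W s = 0.
Proof.
elim: W s => [|L W IH] s us /=; first by case: s us.
rewrite (negbTE us) big1 => [|a _]; first by rewrite !mulr0 addr0.
by rewrite IH //= negb_and us orbT.
Qed.

Section Bounded.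
Variables (sg : nat -> nat -> R) (sg1 : forall a b, `|sg a b| <= 1).

Lemma prod_sg_le1 (T : Type) (s : seq T) (F : T -> nat) a :
  `|\prod_(v <- s) sg a (F v)| <= 1.
Proof.
by rewrite normr_prod prodr_ile1 // => v _; rewrite normr_ge0 sg1.
Qed.

Lemma annihilate_le1 n c s l : `|annihilate sg n c s l| <= 1.
Proof. by rewrite /annihilate; case: ifP => _; rewrite ?normr0 // prod_sg_le1. Qed.

(** Power counting. A creation sums [n] terms, and [n * n^(-1/2) * n^(-(m+1)/2) = n^(-m/2)]. An
    annihilation has at most [m] terms, each of order [n^(-1/2) * n^(-(m-1)/2)]. [K] depends on
    neither [n] nor [s]. *)
Lemma sign_value_bound W m : exists2 K : R, 0 <= K &
  forall n s, (0 < n)%N -> size s = m ->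
    `|sign_value sg n W s| <= K / Num.sqrt n%:R ^+ m.
Proof.
elim: W m => [|L W IH] m /=.
  exists 1 => // n [|u s] n0 /= <-.
    by rewrite normr1 expr0 divr1.
  rewrite normr0.
  by rewrite mulr_ge0 ?invr_ge0 ?exprn_ge0 ?sqrtr_ge0.
have [K1 K10 hK1] := IH m.+1; have [K2 K20 hK2] := IH m.-1.
exists (`|lcre L| * K1 + `|lann L| * (m%:R * K2)).
  by rewrite addr_ge0 ?mulr_ge0.
move=> n s n0 sm; set r := Num.sqrt _.
have r0 : 0 < r by rewrite sqrtr_gt0 ltr0n.
have rr : r * r = n%:R by rewrite -expr2 sqr_sqrtr.
rewrite mulrDl; apply: le_trans (ler_normD _ _) _; apply: lerD.
  rewrite normrM -mulrA; apply: ler_wpM2l => //.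
  rewrite normrM gtr0_norm ?invr_gt0 //.
  rewrite ler_pdivrMl //.
  apply: le_trans (ler_norm_sum _ _ _) _.
  apply: le_trans (ler_sum _ (fun a _ => hK1 n ((nat_of_ord a, lup L) :: s) n0 _)) _.
    by rewrite /= sm.
  rewrite sumr_const card_ord -[leLHS]mulr_natr -/r -rr exprS.
  rewrite le_eqVlt; apply/orP; left; apply/eqP.
  by field; rewrite expf_neq0 gt_eqF.
rewrite normrM -[leRHS]mulrA; apply: ler_wpM2l => //.
rewrite normrM gtr0_norm ?invr_gt0 //.
rewrite ler_pdivrMl //; case: ifP => us; last first.
  by rewrite normr0 !mulr_ge0 // ?invr_ge0 ?exprn_ge0 // ltW.
apply: le_trans (ler_norm_sum _ _ _) _.
have h (l : 'I_(size s)) : true ->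
    `|annihilate sg n (ldown L) s l * sign_value sg n W (omit l s)| <=
    K2 / r ^+ m.-1.
  move=> _; rewrite normrM -[leRHS]mul1r; apply: ler_pM => //.
    exact: annihilate_le1.
  by apply: hK2 => //; rewrite size_omit ?sm.
apply: le_trans (ler_sum _ h) _.
(* For [m = 0] the truncation in [m.-1] is harmless, since the sum over [l] is empty. *)
rewrite sumr_const card_ord sm -[leLHS]mulr_natr; case: m {IH hK1 hK2 sm h} => [|m] /=.
  by rewrite mulr0 !mulr_ge0 ?invr_ge0 ?exprn_ge0 // ltW.
rewrite exprS le_eqVlt; apply/orP; left; apply/eqP.
by field; rewrite expf_neq0 gt_eqF.
Qed.

End Bounded.
End Words.

(** * Convergence for a fixed matrix close to [q] in the cut norm *)

Section Convergence.
Variables (R : realType) (C : eqType) (q : R) (sg : nat -> nat -> R).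
Hypotheses (q1 : `|q| <= 1) (sg1 : forall a b, `|sg a b| <= 1).

(* [sg - q] is small in the cut norm. *)
Variable delta : nat -> R.
Hypothesis sg_flat : forall n (f : nat -> R), (forall a, `|f a| <= 1) ->
  \sum_(b < n) `|\sum_(a < n) f a * (sg a b - q)| <= delta n * n%:R ^+ 2.
Hypothesis delta0 : delta @ \oo --> (0 : R).

(** Induction on [g]: the factor [sg a b] of the first label [b] is absorbed into the test function,
    which stays bounded by 1. Replacing the sum of [f a * sg a b] by [q] times the sum of [f a] then
    costs one cut norm error per label. *)
Lemma label_sum_prod_sg n (g : seq C) (f : nat -> R) : (forall a, `|f a| <= 1) ->
  label_sum n g (fun s => `|\sum_(a < n) f a * \prod_(v <- s) sg a v.1 -
                            q ^+ size g * \sum_(a < n) f a|)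
  <= (size g)%:R * delta n * n%:R ^+ (size g).+1.
Proof.
elim: g f => [|c g IH] f f1 /=.
  rewrite !mul0r expr0 mul1r.
  by under eq_bigr do rewrite big_nil mulr1; rewrite subrr normr0.
have fsg1 (b : nat) a : `|f a * sg a b| <= 1.
  by rewrite normrM mulr_ile1.
have H (b : 'I_n) : true -> label_sum n g (fun s =>
     `|\sum_(a < n) f a * \prod_(v <- (nat_of_ord b, c) :: s) sg a v.1 -
       q ^+ (size g).+1 * \sum_(a < n) f a|) <=
     (size g)%:R * delta n * n%:R ^+ (size g).+1 +
     `|\sum_(a < n) f a * (sg a b - q)| * n%:R ^+ size g.
  move=> _; apply: le_trans (lerD (IH _ (fsg1 b)) (lexx _)).
  rewrite -label_sum_cst -label_sumD; apply: ler_label_sum => s _.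
  have -> : \sum_(a < n) f a * (sg a b - q) =
            \sum_(a < n) f a * sg a b - q * \sum_(a < n) f a.
    by rewrite mulr_sumr -sumrB; apply: eq_bigr => a _; ring.
  have -> : \sum_(a < n) f a * \prod_(v <- (nat_of_ord b, c) :: s) sg a v.1 =
            \sum_(a < n) f a * sg a b * \prod_(v <- s) sg a v.1.
    by apply: eq_bigr => a _; rewrite big_cons mulrA.
  set x := \sum_(a < n) f a * sg a b * _; set y := \sum_(a < n) f a * sg a b.
  set z := \sum_(a < n) f a.
  have -> : x - q ^+ (size g).+1 * z =
            (x - q ^+ size g * y) + q ^+ size g * (y - q * z).
    by rewrite exprS; ring.
  apply: le_trans (ler_normD _ _) _; rewrite lerD2l normrM.
  by rewrite ler_piMl // normrX exprn_ile1.
apply: le_trans (ler_sum _ H) _.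
rewrite big_split /= sumr_const card_ord -mulr_suml.
apply: le_trans (lerD (lexx _) (ler_wpM2r _ (sg_flat n f1))) _.
  by rewrite exprn_ge0.
rewrite -[X in X + _]mulr_natr le_eqVlt; apply/orP; left; apply/eqP.
by rewrite -[(size g).+1%:R]natr1 !exprS; ring.
Qed.

Lemma omit_cat (T : Type) (s1 s2 : seq T) u : omit (size s1) (s1 ++ u :: s2) = s1 ++ s2.
Proof.
by rewrite /omit take_size_cat // drop_cat ltnNge leqnSn subSn ?subnn //= drop0.
Qed.

(** The label of the removed element becomes the inner summation variable [a]. The larger list is
    duplicate-free when [(a, c)] is not in [s] and [s] is duplicate-free; the latter condition is
    built into [sign_value]. *)
Lemma label_sum_annihilate n (W : seq (letter R C)) (g1 g2 : seq C) c :
  label_sum n (g1 ++ c :: g2) (fun s => if uniq s then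
     annihilate sg n c s (size g1) * sign_value sg n W (omit (size g1) s) else 0) =
  label_sum n (g1 ++ g2) (fun s => sign_value sg n W s *
     \sum_(a < n) ((nat_of_ord a, c) \notin s)%:R *
        \prod_(v <- take (size g1) s) sg a v.1).
Proof.
rewrite !label_sum_cat; apply: eq_label_sum => s1 /andP[/eqP g1E _] /=.
under [RHS]eq_label_sum do rewrite mulr_sumr.
rewrite label_sum_sum; apply: eq_bigr => a _.
apply: eq_label_sum => s2 _; rewrite -g1E size_map omit_cat take_size_cat //.
rewrite /annihilate take_size_cat // nth_cat ltnn subnn /= eqxx ltn_ord /=.
have -> : uniq (s1 ++ (nat_of_ord a, c) :: s2) =
   ((nat_of_ord a, c) \notin s1 ++ s2) && uniq (s1 ++ s2).
  by rewrite -cat1s uniq_catCA /=.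
case: ifP => [/andP[-> _]|]; first by rewrite mul1r mulrC.
have [us|us] := boolP (uniq (s1 ++ s2)); last by rewrite sign_value_nuniq // mul0r.
by rewrite andbT => ->; rewrite mul0r mulr0.
Qed.

Lemma sum_mem_fst n (s : seq (nat * C)) c :
  \sum_(a < n) ((nat_of_ord a, c) \in s)%:R <= (size s)%:R :> R.
Proof.
apply: (@le_trans _ _ (\sum_(a < n) (nat_of_ord a \in map fst s))%:R).
  rewrite natr_sum; apply: ler_sum => a _; rewrite ler_nat.
  by case: ((_, c) \in s) / boolP => // /(map_f fst) ->.
rewrite ler_nat -(big_mkord xpredT (fun a => nat_of_bool (a \in map fst s))).
rewrite -big_mkcond sum1_count /= -size_filter -(size_map fst s).
apply: uniq_leq_size; first by rewrite filter_uniq ?iota_uniq.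
by move=> a; rewrite mem_filter => /andP[].
Qed.

(** The condition [\notin] excludes at most [size s] labels; what remains is the error estimated by
    [label_sum_prod_sg] with [f = 1]. *)
Lemma norm_sub_weight n (g1 : seq C) c (s : seq (nat * C)) :
  `|\sum_(a < n) ((nat_of_ord a, c) \notin s)%:R *
      \prod_(v <- take (size g1) s) sg a v.1 - n%:R * q ^+ size g1| <=
  (size s)%:R +
  `|\sum_(a < n) 1 * \prod_(v <- take (size g1) s) sg a v.1 -
    q ^+ size g1 * \sum_(a < n) 1|.
Proof.
rewrite sumr_const card_ord [q ^+ _ * _]mulrC.
set p := fun a : nat => \prod_(v <- take (size g1) s) sg a v.1.
have -> : \sum_(a < n) ((nat_of_ord a, c) \notin s)%:R * p a =
   - (\sum_(a < n) ((nat_of_ord a, c) \in s)%:R * p a) + \sum_(a < n) 1 * p a.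
  rewrite addrC -sumrB; apply: eq_bigr => a _.
  by case: (_ \in _); rewrite /= ?mul0r ?mul1r ?subr0 ?subrr.
rewrite -addrA; apply: le_trans (ler_normD _ _) _.
rewrite lerD2r normrN; apply: le_trans (sum_mem_fst n s c).
apply: le_trans (ler_norm_sum _ _ _) _; apply: ler_sum => a _.
by rewrite normrM ger0_norm // ler_piMr // prod_sg_le1.
Qed.

Definition scaled_value (W : seq (letter R C)) g n : R :=
  label_sum n g (sign_value sg n W) / Num.sqrt n%:R ^+ size g.

(** The exponent exceeds [size (g1 ++ g2)] by 2: one factor comes from the annihilating letter, one
    from the list being longer by one element. Their product [n] normalises the sum over the label
    of that element, which leaves [q ^+ size g1]. *)
Lemma cvg_annihilate (W : seq (letter R C)) g1 g2 c (l : R) :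
  scaled_value W (g1 ++ g2) @ \oo --> l ->
  (fun n => label_sum n (g1 ++ c :: g2) (fun s => if uniq s then
       annihilate sg n c s (size g1) * sign_value sg n W (omit (size g1) s) else 0)
     / Num.sqrt n%:R ^+ (size (g1 ++ g2)).+2) @ \oo --> q ^+ size g1 * l.
Proof.
move=> cl; set m := size (g1 ++ g2).
have [K K0 hK] := @sign_value_bound R C sg sg1 W m.
set X := fun n : nat => _ : R.
(* The term in [1 / n] pays for the excluded labels, the one in [delta] for the cut norm error; [K]
   bounds the values of [W]. *)
pose B n : R := K * (m%:R * n%:R^-1 + (size g1)%:R * delta n).
have main : \forall n \near \oo,
    `|X n - q ^+ size g1 * scaled_value W (g1 ++ g2) n| <= B n.
  near=> n; have n0 : (0 < n)%N by near: n; exact: nbhs_infty_gt.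
  rewrite /X /scaled_value -/m label_sum_annihilate; set r := Num.sqrt _.
  have r0 : 0 < r by rewrite sqrtr_gt0 ltr0n.
  have rr : n%:R = r ^+ 2 by rewrite sqr_sqrtr.
  set S := label_sum _ _ _; set S' := label_sum _ _ _.
  have -> : S / r ^+ m.+2 - q ^+ size g1 * (S' / r ^+ m) =
            (S - n%:R * q ^+ size g1 * S') / r ^+ m.+2.
    rewrite rr !exprS expr0.
    by field; rewrite expf_neq0 gt_eqF.
  rewrite normrM [X in _ * X]gtr0_norm ?invr_gt0 ?exprn_gt0 //.
  rewrite ler_pdivrMr ?exprn_gt0 //.
  rewrite -label_sumZ -mulN1r -label_sumZ -label_sumD.
  apply: le_trans (ler_norm_label_sum _ _ _) _.
  have H s : labelling n (g1 ++ g2) s ->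
      `|sign_value sg n W s *
         (\sum_(a < n) ((nat_of_ord a, c) \notin s)%:R *
           \prod_(v <- take (size g1) s) sg a v.1) +
        -1 * (n%:R * q ^+ size g1 * sign_value sg n W s)| <=
      K / r ^+ m * (m%:R + `|\sum_(a < n) 1 * \prod_(v <- take (size g1) s) sg a v.1 -
         q ^+ size g1 * \sum_(a < n) 1|).
    move=> /andP[/eqP gs _]; have sm : size s = m by rewrite /m -gs size_map.
    rewrite mulN1r [n%:R * _ * _]mulrC -mulrBr normrM; apply: ler_pM => //.
      exact: hK.
    by rewrite -sm; exact: norm_sub_weight.
  apply: le_trans (ler_label_sum H) _.
  rewrite label_sumZ label_sumD label_sum_cst -/m.
  have H2 : label_sum n (g1 ++ g2) (fun s =>
     `|\sum_(a < n) 1 * \prod_(v <- take (size g1) s) sg a v.1 -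
         q ^+ size g1 * \sum_(a < n) 1|) <=
     (size g1)%:R * delta n * n%:R ^+ m.+1.
    rewrite label_sum_cat.
    have -> : (size g1)%:R * delta n * n%:R ^+ m.+1 =
      n%:R ^+ size g2 * ((size g1)%:R * delta n * n%:R ^+ (size g1).+1).
      by rewrite /m size_cat addnC -addnS exprD; ring.
    apply: le_trans (ler_wpM2l _ (label_sum_prod_sg n g1 (f := fun=> 1) _)).
    - rewrite -label_sumZ; apply: ler_label_sum => s1 /andP[/eqP gs _].
      rewrite -gs size_map; under eq_label_sum do rewrite take_size_cat //.
      by rewrite label_sum_cst mulrC.
    - by rewrite exprn_ge0.
    - by move=> _; rewrite normr1.
  apply: le_trans (ler_wpM2l _ (lerD (lexx _) H2)) _.
    by rewrite mulr_ge0 ?invr_ge0 ?exprn_ge0 // ltW.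
  rewrite /B le_eqVlt; apply/orP; left; apply/eqP.
  have e : n%:R ^+ m = r ^+ m * r ^+ m by rewrite rr expr2 exprMn.
  rewrite !exprS e rr expr2.
  by field; rewrite expf_neq0 gt_eqF.
have B0 : B n @[n --> \oo] --> (0 : R).
  rewrite -[X in _ --> X](_ : K * (m%:R * 0 + (size g1)%:R * 0) = 0); last by ring.
  apply: cvgMl_tmp; apply: cvgD; apply: cvgMl_tmp => //.
  by rewrite -(@cvg_shiftS R (fun n => n%:R^-1 : R)); exact: cvg_harmonic.
have D0 : (X n - q ^+ size g1 * scaled_value W (g1 ++ g2) n) @[n --> \oo] --> (0 : R).
  apply: norm_cvg0; apply: squeeze_cvgr (cvg_cst 0) B0.
  by apply: filterS main => n ->; rewrite normr_ge0.
rewrite -[X in _ --> X]add0r.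
have -> : X = (fun n => (X n - q ^+ size g1 * scaled_value W (g1 ++ g2) n) +
                 q ^+ size g1 * scaled_value W (g1 ++ g2) n).
  by apply/funext => n; rewrite subrK.
by apply: cvgD => //; apply: cvgMl_tmp.
Unshelve. all: by end_near.
Qed.

Lemma cvg_sign_value (W : seq (letter R C)) g :
  scaled_value W g @ \oo --> fock_value q W g.
Proof.
elim: W g => [|L W IH] g /=.
  case: g => [|c g] /=.
    have -> : scaled_value [::] [::] = fun=> 1.
      by apply/funext => n; rewrite /scaled_value /= divr1.
    exact: cvg_cst.
  have -> : scaled_value [::] (c :: g) = fun=> 0; last exact: cvg_cst.
  apply/funext => n; rewrite /scaled_value; apply/eqP; rewrite mulf_eq0; apply/orP; left.
  rewrite (@eq_label_sum _ _ _ _ _ (fun=> 0)) ?label_sum_cst ?mul0r //.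
  by move=> [|u s] // /andP[].
(* Contribution of the removal of the [l]-th element; the extra power is the [1 / sqrt n] of the
   letter. *)
pose Y (l : nat) n := label_sum n g (fun s => if uniq s then
     annihilate sg n (ldown L) s l * sign_value sg n W (omit l s) else 0)
     / Num.sqrt n%:R ^+ (size g).+1.
have -> : scaled_value (L :: W) g = fun n =>
    lcre L * scaled_value W (lup L :: g) n + lann L * \sum_(l < size g) Y l n.
  apply/funext => n; rewrite /scaled_value [sign_value _ _ _]/=.
  rewrite label_sumD !label_sumZ mulrDl; congr (_ + _).
    rewrite -mulrA; congr (_ * _); rewrite label_sum_sum /= exprS invfM.
    by rewrite mulrCA mulrA.
  rewrite -mulrA; congr (_ * _); rewrite -mulr_suml exprS invfM.
  rewrite -mulrA mulrCA -label_sum_sum; congr (_ * _).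
  apply: eq_label_sum => s /andP[/eqP <- _]; rewrite size_map.
  by case: (uniq s); rewrite ?big1_eq.
apply: cvgD; first by apply: cvgMl_tmp; exact: IH.
apply: cvgMl_tmp.
apply: (@cvg_big _ _ +%R); first exact: add_continuous.
move=> l _.
have gE : g = take l g ++ nth (ldown L) g l :: drop l.+1 g.
  by rewrite -drop_nth // cat_take_drop.
have lE : size (take l g) = l by rewrite size_take ltn_ord.
have szE : (size g).+1 = (size (omit l g)).+2.
  by rewrite size_omit // prednK // (leq_trans _ (ltn_ord l)).
case: eqP => [cE|cE].
  have := @cvg_annihilate W (take l g) (drop l.+1 g) (nth (ldown L) g l) _ (IH _).
  by rewrite -gE lE -/(omit l g) -szE cE.
(* The colours differ, so the term vanishes in both models. *)
rewrite mul0r (_ : Y l = fun=> 0); first exact: cvg_cst.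
apply/funext => n; rewrite /Y (@eq_label_sum _ _ _ _ _ (fun=> 0)).
  by rewrite label_sum_cst !mul0r.
move=> s /andP[/eqP gs _]; case: ifP => // _.
have ls : (l < size s)%N by rewrite -(size_map snd s) gs.
rewrite /annihilate (_ : _ == _ = false) ?mul0r //.
apply/eqP => h; apply: cE; apply: etrans h.
by have := nth_map (0%N, ldown L) (ldown L) snd ls; rewrite gs.
Qed.

End Convergence.

(** * Cut norm and 4-cycles *)

Section QuasiRandom.
Variables (R : realType) (q : R).
Implicit Types (sg : nat -> nat -> R) (n : nat).

(** With [A] the matrix [sg - q], this is the trace of [(A A^T)^2], hence that of [A^4] for
    symmetric [sg]. *)
Definition four_cycles sg n : R :=
  \sum_(a < n) \sum_(b < n) (\sum_(c < n) (sg a c - q) * (sg b c - q)) ^+ 2.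

(** Cauchy-Schwarz against the constant 1: the sum of all [(x i - x j)^2] is twice the difference of
    the two sides. *)
Lemma sqr_sum_le (I : finType) (x : I -> R) :
  (\sum_i x i) ^+ 2 <= #|I|%:R * \sum_i x i ^+ 2.
Proof.
have : 0 <= \sum_i \sum_j (x i - x j) ^+ 2.
  by apply: sumr_ge0 => i _; apply: sumr_ge0 => j _; exact: sqr_ge0.
have -> : \sum_i \sum_j (x i - x j) ^+ 2 =
          2 * (#|I|%:R * \sum_i x i ^+ 2 - (\sum_i x i) ^+ 2).
  pose A := \sum_i \sum_(j : I) x i ^+ 2; pose B := \sum_(i : I) \sum_j x j ^+ 2.
  have AE : A = #|I|%:R * \sum_i x i ^+ 2.
    rewrite /A mulr_sumr; apply: eq_bigr => i _.
    by rewrite sumr_const mulr_natl.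
  have BE : B = A by rewrite /B exchange_big.
  have CE : (\sum_i x i) ^+ 2 = \sum_i \sum_j x i * x j.
    by rewrite expr2 mulr_suml; apply: eq_bigr => i _; rewrite mulr_sumr.
  rewrite CE -AE.
  transitivity (A + B - 2 * \sum_i \sum_j x i * x j); last by rewrite BE; ring.
  rewrite /A /B mulr_sumr -big_split -sumrB /=; apply: eq_bigr => i _.
  rewrite mulr_sumr -big_split -sumrB /=; apply: eq_bigr => j _.
  by ring.
by rewrite pmulr_rge0 // subr_ge0.
Qed.

Lemma four_cycles_ge0 sg n : 0 <= four_cycles sg n.
Proof. by apply: sumr_ge0 => a _; apply: sumr_ge0 => b _; exact: sqr_ge0. Qed.

(* The number of 4-cycles bounds the fourth power of the operator norm, by two
   applications of the Cauchy-Schwarz inequality. *)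
Lemma four_cycles_flat sg n (f : nat -> R) : (forall a, `|f a| <= 1) ->
  \sum_(b < n) `|\sum_(a < n) f a * (sg a b - q)| <=
  Num.sqrt (Num.sqrt (four_cycles sg n / n%:R ^+ 4)) * n%:R ^+ 2.
Proof.
move=> f1; have [->|n0] := posnP n; first by rewrite big_ord0 expr2 !mulr0.
set X := \sum_(b < n) _; have X0 : 0 <= X by exact: sumr_ge0.
pose Y := \sum_(i : 'I_n * 'I_n) `|\sum_(b < n) (sg i.1 b - q) * (sg i.2 b - q)|.
have Y0 : 0 <= Y by exact: sumr_ge0.
(* First Cauchy-Schwarz, over [b]: expanding the square produces pairs of rows, and the factors [f]
   are bounded by 1. *)
have XY : X ^+ 2 <= n%:R * Y.
  apply: le_trans (sqr_sum_le _) _; rewrite card_ord; apply: ler_wpM2l => //.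
  under eq_bigr do rewrite real_normK ?num_real // expr2 mulr_suml.
  rewrite exchange_big /=.
  rewrite /Y -(pair_bigA _ (fun a b : 'I_n =>
    `|\sum_(c < n) (sg a c - q) * (sg b c - q)|)) /=.
  apply: ler_sum => a _.
  under eq_bigr do rewrite mulr_sumr.
  rewrite exchange_big /=; apply: ler_sum => b _.
  have -> : \sum_(c < n) f a * (sg a c - q) * (f b * (sg b c - q)) =
            f a * f b * \sum_(c < n) (sg a c - q) * (sg b c - q).
    by rewrite mulr_sumr; apply: eq_bigr => c _; ring.
  apply: le_trans (ler_norm _) _; rewrite normrM ler_piMl //.
  by rewrite normrM mulr_ile1.
(* Second Cauchy-Schwarz, over the [n^2] pairs of rows. *)
have YF : Y ^+ 2 <= n%:R ^+ 2 * four_cycles sg n.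
  apply: le_trans (sqr_sum_le _) _; rewrite card_prod card_ord natrM -expr2.
  apply: ler_wpM2l; first exact: exprn_ge0.
  rewrite /four_cycles (pair_bigA _ (fun a b : 'I_n =>
    (\sum_(c < n) (sg a c - q) * (sg b c - q)) ^+ 2)) /=.
  by apply: ler_sum => i _; rewrite real_normK ?num_real.
have n0' : 0 < n%:R :> R by rewrite ltr0n.
(* Up to fourth roots the claim is [X^4 <= n^4 * four_cycles sg n], which combines [XY] and [YF]. *)
rewrite -ler_pdivrMr ?exprn_gt0 //.
rewrite -[leLHS]ger0_norm ?divr_ge0 ?exprn_ge0 // -sqrtr_sqr ler_wsqrtr //.
rewrite -[leLHS]ger0_norm ?sqr_ge0 // -sqrtr_sqr ler_wsqrtr //.
rewrite ler_pdivlMr ?exprn_gt0 //.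
have -> : ((X / n%:R ^+ 2) ^+ 2) ^+ 2 * n%:R ^+ 4 = (X ^+ 2) ^+ 2 / n%:R ^+ 4.
  by field; rewrite gt_eqF.
rewrite ler_pdivrMr ?exprn_gt0 //.
apply: (@le_trans _ _ ((n%:R * Y) ^+ 2)).
  by rewrite ler_sqr ?nnegrE ?sqr_ge0 ?mulr_ge0.
rewrite exprMn; apply: le_trans (ler_wpM2l (exprn_ge0 _ _) YF) _ => //.
by rewrite mulrA -exprD mulrC.
Qed.

Lemma four_cycles_cvg sg :
  four_cycles sg n / n%:R ^+ 4 @[n --> \oo] --> (0 : R) ->
  Num.sqrt (Num.sqrt (four_cycles sg n / n%:R ^+ 4)) @[n --> \oo] --> (0 : R).
Proof.
move=> h; rewrite -sqrtr0; apply: continuous_cvg; first exact: sqrt_continuous.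
by rewrite -sqrtr0; apply: continuous_cvg; first exact: sqrt_continuous.
Qed.

(** In [G p r] the outer indices run below [p] and the inner one below [r]. Enlarging [p] only adds
    squares. The identity [GC], that is, [tr (A A^T)^2 = tr (A^T A)^2], exchanges the two ranges, so
    that [r] can be enlarged in the same way. *)
Lemma four_cycles_homo sg m n : (m <= n)%N -> four_cycles sg m <= four_cycles sg n.
Proof.
pose G p r : R := \sum_(a < p) \sum_(b < p)
  (\sum_(c < r) (sg a c - q) * (sg b c - q)) ^+ 2.
have GC p r : G p r =
    \sum_(c < r) \sum_(d < r) (\sum_(a < p) (sg a c - q) * (sg a d - q)) ^+ 2.
  under eq_bigr do under eq_bigr do rewrite expr2 mulr_suml.
  under eq_bigr do rewrite exchange_big /=.
  rewrite exchange_big /=; apply: eq_bigr => c _.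
  under eq_bigr do under eq_bigr do rewrite mulr_sumr.
  under eq_bigr do rewrite exchange_big /=.
  rewrite exchange_big /=; apply: eq_bigr => d _.
  rewrite expr2 mulr_suml; apply: eq_bigr => a _.
  by rewrite mulr_sumr; apply: eq_bigr => b _; ring.
have widen (H : nat -> nat -> R) : (m <= n)%N -> (forall a b, 0 <= H a b) ->
    \sum_(a < m) \sum_(b < m) H a b <= \sum_(a < n) \sum_(b < n) H a b.
  move=> mn H0; rewrite (big_ord_widen n (fun a => \sum_(b < m) H a b)) //.
  rewrite [leRHS](bigID (fun a : 'I_n => (a < m)%N)) /= -[leLHS]addr0 lerD //.
    apply: ler_sum => a _; rewrite (big_ord_widen n (H a)) //.
    rewrite [leRHS](bigID (fun b : 'I_n => (b < m)%N)) /= lerDl.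
    by apply: sumr_ge0.
  by apply: sumr_ge0 => a _; exact: sumr_ge0.
move=> mn; apply: (@le_trans _ _ (G n m)).
  rewrite /four_cycles /G; apply: (widen (fun a b =>
    (\sum_(c < m) (sg a c - q) * (sg b c - q)) ^+ 2)) => // a b.
  exact: sqr_ge0.
rewrite /four_cycles -/(G n n) !GC; apply: (widen (fun c d =>
  (\sum_(a < n) (sg a c - q) * (sg a d - q)) ^+ 2)) => // c d.
exact: sqr_ge0.
Qed.

End QuasiRandom.

(** * Almost sure behaviour of the random signs *)

Section SignMoments.
Context d (T : measurableType d) (R : realType) (P : probability T R).
Variables (q : R) (eps : nat -> nat -> {RV P >-> R}).
Hypothesis heps : random_signs q eps.

(** Signs are handled through the indicators of these events, so that expectations of products
    reduce to probabilities of intersections. *)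
Definition minus_event (ii : nat * nat) : set T := eps ii.1 ii.2 @^-1` [set -1].

Lemma measurable_minus_event ii : measurable (minus_event ii).
Proof. exact: measurable_funPTI. Qed.

Lemma measurable_bigcap_minus_event (s : seq (nat * nat)) :
  measurable (\bigcap_(ii in [set` s]) minus_event ii).
Proof.
apply: fin_bigcap_measurable => [|ii _]; first exact: finite_seq.
exact: measurable_minus_event.
Qed.

Lemma prob_minus_event ii : (ii.2 < ii.1)%N ->
  P (minus_event ii) = ((1 - q) / 2)%:E.
Proof.
case: heps => _ law _ ii21.
have := law _ _ ii21 _ (measurable_set1 (-1 : R)).
rewrite /distribution /pushforward /= => ->.
have h1 : ((1 : R) \in [set (-1 : R)]) = false.
  by apply/memNset => /= /eqP; rewrite -subr_eq0 opprK (_ : 1 + 1 = 2%:R) ?pnatr_eq0.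
have h2 : ((-1 : R) \in [set (-1 : R)]) = true by exact/mem_set.
by rewrite !diracE h1 h2 mule0 mule1 add0e.
Qed.

Lemma prob_bigcap_minus_event (s : seq (nat * nat)) : uniq s ->
  {in s, forall ii, (ii.2 < ii.1)%N} ->
  P (\bigcap_(ii in [set` s]) minus_event ii) = (((1 - q) / 2) ^+ size s)%:E.
Proof.
move=> us s21; case: (heps) => _ _ indep.
pose J := [fset ii in s]%fset.
have Js : perm_eq J s.
  by apply: uniq_perm => // ii; rewrite inE.
have := indep J (fun=> [set -1]).
have -> : [set` J] = [set` s] by apply/seteqP; split => x /=; rewrite inE.
move=> -> //; last by move=> ii; rewrite inE => /s21.
rewrite (perm_big _ Js) big_seq /=.
under eq_bigr => ii iis do rewrite prob_minus_event ?s21 //.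
by rewrite -big_seq prodEFin big_const_seq count_predT iter_mulr_1.
Qed.

Let lin (x y : R) (ii : nat * nat) (w : T) : R := x + y * \1_(minus_event ii) w.

Lemma integrable_bounded (f : T -> R) (M : R) : measurable_fun setT f ->
  (forall w, `|f w| <= M) -> P.-integrable setT (EFin \o f).
Proof.
move=> mf fM; apply: measurable_bounded_integrable => //.
  exact: le_lt_trans (probability_le1 P measurableT) (ltry 1).
exists M; split; first by rewrite num_real.
by move=> r Mr w _ /=; apply: le_trans (fM w) (ltW Mr).
Qed.

Lemma measurable_lin x y ii : measurable_fun setT (lin x y ii).
Proof.
apply: measurable_funD => //; apply: measurable_funM => //.
exact/measurable_indic/measurable_minus_event.
Qed.

Lemma lin_bound x y ii w : `|lin x y ii w| <= `|x| + `|y|.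
Proof.
apply: le_trans (ler_normD _ _) _; rewrite lerD2l normrM ler_piMr // indicE.
by case: (_ \in _); rewrite ?normr1 ?normr0.
Qed.

Lemma integrable_prod_lin x y (s : seq (nat * nat)) (A : set T) : measurable A ->
  P.-integrable setT (EFin \o (fun w => \prod_(ii <- s) lin x y ii w * \1_A w)).
Proof.
move=> mA; apply: (@integrable_bounded _ ((`|x| + `|y|) ^+ size s)).
  apply: measurable_funM; last exact: measurable_indic.
  by apply: measurable_prod => ii _; exact: measurable_lin.
move=> w; rewrite normrM -[leRHS]mulr1; apply: ler_pM => //.
  rewrite normr_prod; elim: s => [|ii s IH]; first by rewrite big_nil expr0.
  by rewrite big_cons exprS; apply: ler_pM => //; [exact: prodr_ge0 | exact: lin_bound].
by rewrite indicE; case: (_ \in _); rewrite ?normr1 ?normr0.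
Qed.

(** Induction on [s], splitting its first factor: the constant part drops it, the indicator part
    moves its event to [t]. For [t] empty this is the product rule for independent factors. *)
Lemma integral_prod_lin x y (s t : seq (nat * nat)) : uniq (s ++ t) ->
  {in s ++ t, forall ii, (ii.2 < ii.1)%N} ->
  (\int[P]_w (\prod_(ii <- s) lin x y ii w *
      \1_(\bigcap_(ii in [set` t]) minus_event ii) w)%:E)%E =
  ((x + y * ((1 - q) / 2)) ^+ size s * ((1 - q) / 2) ^+ size t)%:E.
Proof.
elim: s t => [|u s IH] t ust st21.
  under eq_integral do rewrite big_nil mul1r.
  rewrite integral_indic // ?setIT; last exact: measurable_bigcap_minus_event.
  by rewrite expr0 mul1r; exact: prob_bigcap_minus_event.
have mB := measurable_bigcap_minus_event.
set B := \bigcap_(ii in [set` t]) _.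
have Bu : \bigcap_(ii in [set` u :: t]) minus_event ii = minus_event u `&` B.
  apply/seteqP; split => [w h|w [hu ht] ii /=].
    split; first by apply: h => /=; rewrite mem_head.
    by move=> ii iit; apply: h => /=; rewrite inE iit orbT.
  by rewrite inE => /predU1P[->|/ht].
have p1 : uniq (s ++ t) by move: ust => /= /andP[].
have p2 : uniq (s ++ u :: t) by rewrite -cat1s uniq_catCA.
have q1 : {in s ++ t, forall ii, (ii.2 < ii.1)%N}.
  by move=> ii h; apply: st21; rewrite inE h orbT.
have q2 : {in s ++ u :: t, forall ii, (ii.2 < ii.1)%N}.
  move=> ii; rewrite mem_cat inE orbCA -mem_cat => h; apply: st21.
  by rewrite inE.
transitivity (\int[P]_w (x%:E * (\prod_(ii <- s) lin x y ii w * \1_B w)%:E +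
   y%:E * (\prod_(ii <- s) lin x y ii w *
     \1_(\bigcap_(ii in [set` u :: t]) minus_event ii) w)%:E))%E.
  apply: eq_integral => w _; rewrite -!EFinM -EFinD; congr EFin.
  rewrite big_cons Bu indicI /= {1}/lin; ring.
rewrite integralD //; last 2 first.
- by apply: integrableZl => //; exact: (integrable_prod_lin x y s (mB t)).
- by apply: integrableZl => //; exact: (integrable_prod_lin x y s (mB (u :: t))).
rewrite !integralZl //; last 2 first.
- exact: (integrable_prod_lin x y s (mB (u :: t))).
- exact: (integrable_prod_lin x y s (mB t)).
rewrite IH // IH // -!EFinM -EFinD /=; congr EFin.
by rewrite !exprS; ring.
Qed.

(** The larger index comes first because [random_signs] gives the law and the independence below the
    diagonal. *)
Definition edge (a b : nat) := (maxn a b, minn a b).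

(* Almost surely equal to the random sign, see [ae_indic_sign] *)
Definition indic_sign (w : T) (a b : nat) : R :=
  if a == b then -1 else 1 - 2 * \1_(minus_event (edge a b)) w.

(** Off the diagonal this is a centred variable: its mean is [(1 - q) - 2 * ((1 - q) / 2) = 0]. *)
Lemma indic_signE w a b : a != b -> indic_sign w a b - q = lin (1 - q) (-2) (edge a b) w.
Proof. by move=> /negbTE ab; rewrite /indic_sign ab /lin; ring. Qed.

Lemma measurable_indic_sign a b : measurable_fun setT (fun w => indic_sign w a b - q).
Proof.
have [->|ab] := eqVneq a b.
  by rewrite /indic_sign eqxx; exact: measurable_cst.
by under eq_fun do rewrite indic_signE //; exact: measurable_lin.
Qed.

(** Valid at every [w], whereas [eps] takes its values in [{1, -1}] only almost surely. *)
Lemma indic_sign_le1 w a b : `|indic_sign w a b| <= 1.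
Proof.
rewrite /indic_sign; case: eqP => _; first by rewrite normrN1.
rewrite indicE; case: (_ \in _); rewrite /= ?mulr1 ?mulr0 ?subr0 ?normr1 //.
by rewrite ler_norml; lra.
Qed.

Hypothesis hq : -1 < q < 1.

Lemma indic_sign_le2 w a b : `|indic_sign w a b - q| <= 2.
Proof.
apply: le_trans (ler_normB _ _) _; rewrite [leRHS](_ : 2 = 1 + 1) //.
apply: lerD; first exact: indic_sign_le1.
by rewrite ler_norml; move: hq; lra.
Qed.

Lemma edge_inj a b c e : edge a b = edge c e ->
  ((a == c) && (b == e)) || ((a == e) && (b == c)).
Proof. by rewrite /edge => -[]; lia. Qed.

(** Weight of the closed walk through [i.1.1], [i.2.1], [i.1.2], [i.2.2]. *)
Let cycle_term n (i : 'I_n * 'I_n * ('I_n * 'I_n)) (w : T) : R :=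
  (indic_sign w i.1.1 i.2.1 - q) * (indic_sign w i.1.2 i.2.1 - q) *
  ((indic_sign w i.1.1 i.2.2 - q) * (indic_sign w i.1.2 i.2.2 - q)).

(** Bounds the indicator that two of the four vertices coincide, by a sum whose total over all
    quadruples is explicit. *)
Let collisions n (i : 'I_n * 'I_n * ('I_n * 'I_n)) : R :=
  (i.1.1 == i.1.2)%:R + (i.1.1 == i.2.1)%:R + (i.1.1 == i.2.2)%:R +
  (i.1.2 == i.2.1)%:R + (i.1.2 == i.2.2)%:R + (i.2.1 == i.2.2)%:R.

Let four_cyclesE n w : four_cycles q (indic_sign w) n = \sum_i @cycle_term n i w.
Proof.
rewrite /four_cycles (pair_bigA _ (fun a b : 'I_n =>
   (\sum_(c < n) (indic_sign w a c - q) * (indic_sign w b c - q)) ^+ 2)) /=.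
have sq (f : 'I_n -> R) : (\sum_c f c) ^+ 2 = \sum_(p : 'I_n * 'I_n) f p.1 * f p.2.
  by rewrite expr2 big_distrlr /= pair_bigA.
under eq_bigr do rewrite sq.
by rewrite pair_bigA.
Qed.

Let measurable_cycle_term n i : measurable_fun setT (@cycle_term n i).
Proof. by do ?apply: measurable_funM; exact: measurable_indic_sign. Qed.

Let cycle_term_le n i w : `|@cycle_term n i w| <= 16.
Proof.
rewrite !normrM [leRHS](_ : 16 = (2 * 2) * (2 * 2)); last by ring.
by do ?apply: ler_pM => //; exact: indic_sign_le2.
Qed.

(** A degenerate cycle is at most 16 and has a collision. Otherwise the four edges are distinct, and
    by independence the integral is a product of four vanishing means. *)
Let integral_cycle_term n i :
  (\int[P]_w (@cycle_term n i w)%:E <= (16 * collisions i)%:E)%E.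
Proof.
case: i => -[a b] [c e]; set i := (a, b, (c, e)).
have [col|] := boolP [|| a == b, a == c, a == e, b == c, b == e | c == e].
  apply: (@le_trans _ _ (\int[P]_w cst 16%:E w)%E).
    apply: le_integral => //.
    - exact: (integrable_bounded (@measurable_cycle_term n i) (@cycle_term_le n i)).
    - by apply: (@integrable_bounded (cst 16) 16) => // w; rewrite /cst ger0_norm.
    - by move=> w _; rewrite lee_fin (le_trans (ler_norm _)) // cycle_term_le.
  rewrite integral_cst // [X in (_ * X)%E](@probability_setT _ _ _ P) mule1.
  rewrite lee_fin ler_peMr //.
  rewrite /collisions /=; move: col.
  by do 6!case: (_ == _) => //= ; lra.
rewrite !negb_or => /and5P[ab ac ae bc /andP[be ce]].
have -> : (\int[P]_w (@cycle_term n i w)%:E =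
   \int[P]_w (\prod_(ii <- [:: edge a c; edge b c; edge a e; edge b e])
       lin (1 - q) (-2) ii w * \1_(\bigcap_(ii in [set` [::]]) minus_event ii) w)%:E)%E.
  apply: eq_integral => w _; congr EFin.
  rewrite set_nil bigcap_set0 indicT mulr1 !big_cons big_nil.
  by rewrite /cycle_term /= !indic_signE //; ring.
rewrite integral_prod_lin.
- rewrite lee_fin /= mulr1 (_ : 1 - q + _ = 0); last by field.
  by rewrite expr0n mulr_ge0 // !addr_ge0.
- rewrite cats0 /= !inE !negb_or; do !(apply/andP; split) => //;
    apply/eqP => /edge_inj;
    by move: ab ac ae bc be ce; rewrite -!val_eqE /=; lia.
move=> ii; rewrite cats0 !inE => /or4P[] /eqP -> /=;
  by move: ac ae bc be; rewrite -!val_eqE /=; lia.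
Qed.

(** Each of the six coincidences leaves three free indices. *)
Let sum_collisions n : \sum_i @collisions n i = 6 * n%:R ^+ 3.
Proof.
have e1 (a : 'I_n) : \sum_b (a == b)%:R = 1 :> R.
  by rewrite (bigD1 a) //= eqxx big1 ?addr0 // => b /negbTE; rewrite eq_sym => ->.
have e2 (x : R) : \sum_(b < n) x = x * n%:R by rewrite sumr_const card_ord mulr_natr.
rewrite -(pair_bigA _ (fun ab cd : 'I_n * 'I_n => @collisions n (ab, cd))) /=.
rewrite -(pair_bigA _ (fun a b : 'I_n => \sum_j @collisions n ((a, b), j))) /=.
have e3 (a b : 'I_n) : \sum_p @collisions n ((a, b), p) =
    (a == b)%:R * n%:R ^+ 2 + 4 * n%:R + n%:R.
  rewrite -(pair_bigA _ (fun c e : 'I_n => @collisions n ((a, b), (c, e)))) /=.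
  under eq_bigr do rewrite /collisions /= !big_split /= !e2 !e1.
  by rewrite !big_split /= -!mulr_suml !e2 !e1; ring.
under eq_bigr do under eq_bigr do rewrite e3.
under eq_bigr do rewrite !big_split /= -!mulr_suml !e2 !e1.
by rewrite !big_split /= !e2; ring.
Qed.

Lemma integral_four_cycles n :
  (\int[P]_w (four_cycles q (indic_sign w) n)%:E <= (96 * n%:R ^+ 3)%:E)%E.
Proof.
under eq_integral do rewrite four_cyclesE -sumEFin.
rewrite integral_sum //; last first.
  move=> i.
  exact: (integrable_bounded (@measurable_cycle_term n i) (@cycle_term_le n i)).
apply: le_trans (lee_sum _ (fun i _ => integral_cycle_term i)) _.
by rewrite sumEFin lee_fin -mulr_sumr sum_collisions; lra.
Qed.

Lemma measurable_four_cycles n :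
  measurable_fun setT (fun w => four_cycles q (indic_sign w) n).
Proof.
under eq_fun do rewrite four_cyclesE.
by apply: measurable_sum => i; exact: measurable_cycle_term.
Qed.

(** There are countably many pairs, so one pair below the diagonal suffices; there the law gives no
    mass to the complement of [{1, -1}]. *)
Lemma ae_indic_sign :
  {ae P, forall w, forall a b, a != b -> eps a b w = indic_sign w a b}.
Proof.
case: (heps) => sym law _.
suff H a b : (b < a)%N -> {ae P, forall w, eps a b w = indic_sign w a b}.
  apply: ae_foralln => a; apply: ae_foralln => b.
  have [ltab|ltba|->] := ltngtP a b.
  - apply: filterS (H _ _ ltab) => w E _; rewrite sym ?E; last by rewrite neq_ltn ltab.
    by rewrite /indic_sign /edge maxnC minnC eq_sym.
  - by apply: filterS (H _ _ ltba) => w ->.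
  - by apply/aeW => w /eqP.
move=> ba; have ab : a != b by rewrite neq_ltn ba orbT.
pose B : set R := ~` [set 1; -1].
have mB : measurable B by apply: measurableC; exact: measurableU.
exists (eps a b @^-1` B); split.
- exact: measurable_funPTI.
- have := law _ _ ba _ mB; rewrite /distribution /pushforward /= => ->.
  have h1 : ((1 : R) \in B) = false by apply/memNset => /=; apply; left.
  have h2 : ((-1 : R) \in B) = false by apply/memNset => /=; apply; right.
  by rewrite !diracE h1 h2 !mule0 add0e.
move=> w /= H [epsw|epsw]; apply: H; rewrite /indic_sign (negbTE ab) /edge;
  rewrite (maxn_idPl (ltnW ba)) (minn_idPr (ltnW ba)) indicE epsw.
  rewrite (_ : _ \in _ = false) ?mulr0 ?subr0 //.
  apply/memNset; rewrite /minus_event /= epsw => /eqP.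
  by rewrite -subr_eq0 opprK (_ : 1 + 1 = 2%:R) ?pnatr_eq0.
by rewrite mem_set //= mulr1; ring.
Qed.

(** Along the powers of 2 the expectations are summable, so the series of the [Y k] has finite
    expectation, is almost surely finite, and its terms tend to 0. Monotonicity in [n] fills the
    gaps. *)
Lemma ae_four_cycles_cvg : {ae P, forall w,
  four_cycles q (indic_sign w) n / n%:R ^+ 4 @[n --> \oo] --> (0 : R)}.
Proof.
pose Y k w : R := four_cycles q (indic_sign w) (2 ^ k) / (2 ^ k)%:R ^+ 4.
have Y0 k w : 0 <= Y k w by rewrite mulr_ge0 ?invr_ge0 ?exprn_ge0 ?four_cycles_ge0.
have mY k : measurable_fun setT (Y k).
  by apply: measurable_funM => //; exact: measurable_four_cycles.
(* The bound is [96 / 2^k], written in the shape of the geometric series of [epsilon_trick0]. *)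
have iY k : (\int[P]_w (Y k w)%:E <= (192 / (2 ^ k.+1)%:R)%:E)%E.
  under eq_integral do rewrite /Y mulrC EFinM.
  rewrite ge0_integralZl //; last 2 first.
  - by apply/measurable_EFinP; exact: measurable_four_cycles.
  - by move=> w _; rewrite lee_fin four_cycles_ge0.
  apply: le_trans (lee_wpmul2l _ (integral_four_cycles _)) _.
    by rewrite lee_fin invr_ge0 exprn_ge0.
  rewrite -EFinM lee_fin le_eqVlt; apply/orP; left; apply/eqP.
  by rewrite expnS natrM; field; rewrite pnatr_eq0 -lt0n expn_gt0.
have intY : P.-integrable setT (fun w => \sum_(k <oo) (Y k w)%:E)%E.
  apply/integrableP; split.
    by apply: ge0_emeasurable_sum => k *; [rewrite lee_fin | exact/measurable_EFinP].
  under eq_integral => w _.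
    rewrite gee0_abs; last by apply: nneseries_ge0 => k *; rewrite lee_fin.
    over.
  rewrite integral_nneseries //; last 2 first.
  - by move=> k; exact/measurable_EFinP.
  - by move=> k w _; rewrite lee_fin.
  apply: (@le_lt_trans _ _ (\sum_(k <oo) (192 / (2 ^ k.+1)%:R)%:E)%E).
    by apply: lee_nneseries => // k *; apply: integral_ge0 => w _; rewrite lee_fin.
  by apply: le_lt_trans (epsilon_trick0 _ _) (ltry 192).
have := integrable_ae measurableT intY.
apply: filterS => w /(_ I) finY.
have cvgY : Y k w @[k --> \oo] --> (0 : R).
  apply: cvg_series_cvg_0; apply: nondecreasing_is_cvgn.
    by apply/nondecreasing_seqP => k; rewrite /series /= big_nat_recr //= lerDl.
  exists (fine (\sum_(k <oo) (Y k w)%:E)%E) => _ [k _ <-].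
  rewrite -lee_fin fineK // -sumEFin; apply: nneseries_lim_ge => i *.
  by rewrite lee_fin.
apply/cvgrPdist_le => e e0.
(* The power of 2 chosen below is at most [2 * n], which loses a factor [2^4 = 16]. *)
move/cvgrPdist_le : cvgY => /(_ (e / 16)); rewrite divr_gt0 // => /(_ isT) [N _ hN].
exists (2 ^ N)%N => // n /= Nn.
have n0 : (0 < n)%N by apply: leq_trans Nn; rewrite expn_gt0.
have n0' : 0 < n%:R :> R by rewrite ltr0n.
have F0 := four_cycles_ge0 q (indic_sign w) n.
rewrite sub0r normrN ger0_norm ?mulr_ge0 ?invr_ge0 ?exprn_ge0 //.
pose k := (trunc_log 2 n).+1.
have nk : (n < 2 ^ k)%N by exact: trunc_log_ltn.
have kn : (2 ^ k <= 2 * n)%N by rewrite /k expnS leq_mul2l trunc_logP.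
have Nk : (N <= k)%N by rewrite -(leq_exp2l _ _ (isT : 1 < 2)%N) (leq_trans Nn) // ltnW.
have := hN k Nk; rewrite /= sub0r normrN ger0_norm // /Y.
have k0 : 0 < (2 ^ k)%:R :> R by rewrite ltr0n expn_gt0.
rewrite ler_pdivrMr ?exprn_gt0 // => h.
rewrite ler_pdivrMr ?exprn_gt0 //.
apply: le_trans (four_cycles_homo q _ (ltnW nk)) _; apply: le_trans h _.
rewrite -mulrA ler_pM2l // ler_pdivrMl //.
have -> : 16 * n%:R ^+ 4 = (2 * n%:R) ^+ 4 :> R by rewrite exprMn; congr (_ * _); ring.
by rewrite lerXn2r ?nnegrE ?mulr_ge0 // -natrM ler_nat.
Qed.

End SignMoments.

(** * Hilbert spaces *)

Section Inner.
Variables (R : realType) (H : hilbertType R).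
Implicit Types (x y z : H) (a : R[i]).

Lemma inner_conj x y : inner x y = Num.conj (inner y x).
Proof. by rewrite /inner hermC expr0 mul1r. Qed.

Lemma innerDr x y z : inner x (y + z) = inner x y + inner x z.
Proof. exact: linearDl. Qed.

Lemma innerZr a x y : inner x (a *: y) = a * inner x y.
Proof. exact: linearZl_LR. Qed.

Lemma inner0r x : inner x 0 = 0.
Proof. exact: linear0l. Qed.

Lemma innerBr x y z : inner x (y - z) = inner x y - inner x z.
Proof. exact: linearBl. Qed.

Lemma inner_sumr (I : Type) (s : seq I) (P : pred I) (F : I -> H) x :
  inner x (\sum_(i <- s | P i) F i) = \sum_(i <- s | P i) inner x (F i).
Proof. exact: linear_sumlz. Qed.

Lemma innerDl x y z : inner (y + z) x = inner y x + inner z x.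
Proof. exact: linearDr. Qed.

Lemma innerZl a x y : inner (a *: y) x = Num.conj a * inner y x.
Proof. exact: linearZr_LR. Qed.

Lemma inner0l x : inner 0 x = 0.
Proof. exact: linear0r. Qed.

Lemma inner_suml (I : Type) (s : seq I) (P : pred I) (F : I -> H) x :
  inner (\sum_(i <- s | P i) F i) x = \sum_(i <- s | P i) inner (F i) x.
Proof. exact: linear_sumr. Qed.

(** If [x] is nonzero, the ball around [x] of radius its norm contains some [y] in [S], but by
    Pythagoras the distance from [x] to [y] is at least the norm of [x]. *)
Lemma orthogonal_dense (S : set H) x :
  dense S -> (forall y, S y -> inner y x = 0) -> x = 0.
Proof.
move=> dS Sx; apply/eqP/negPn/negP => x0.
have {}x0 : 0 < `|x| by rewrite normr_gt0.
have [] := dS (ball x `|x|).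
- by exists x; exact: ballxx.
- exact: ball_open.
move=> y [+ Sy]; rewrite -ball_normE /ball_ /= => xy.
have : `|x| ^+ 2 <= `|x - y| ^+ 2.
  have -> : `|x - y| ^+ 2 = `|x| ^+ 2 + `|y| ^+ 2.
    have xy0 : inner x y = 0 by rewrite inner_conj Sx // rmorph0.
    rewrite !hdotE -!/(inner _ _) innerBr -[x - y]addrC -scaleN1r.
    rewrite !innerDl !innerZl Sx // xy0 rmorphN1.
    by rewrite mulr0 add0r addr0 mulN1r opprK.
  by rewrite lerDl exprn_ge0.
by apply/negP; rewrite lt_geF // ltr_pXn2r ?nnegrE.
Qed.

Lemma eq_inner_dense (S : set H) x x' :
  dense S -> (forall y, S y -> inner y x = inner y x') -> x = x'.
Proof.
move=> dS h; apply/eqP; rewrite -subr_eq0; apply/eqP.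
by apply: orthogonal_dense dS _ => y Sy; rewrite innerBr h // subrr.
Qed.

(** Uniqueness of the adjoint: the difference [A x - S x] is orthogonal to every vector, in
    particular to itself. *)
Lemma adjointP (T S : H -> H) : is_adjoint T S -> adjoint T = S.
Proof.
move=> TS; rewrite /adjoint; have := @xgetPex _ (fun=> 0) [set S | is_adjoint T S].
move=> /(_ (ex_intro _ S TS)) TA; apply/funext => x.
apply/eqP; rewrite -subr_eq0 -normr_eq0 -sqrf_eq0 hdotE -/(inner _ _); apply/eqP.
set A := xget _ _ in TA *; set y := A x - S x.
by rewrite /y -scaleN1r innerDl innerZl TA TS rmorphN rmorph1 mulN1r subrr.
Qed.

Lemma is_adjoint_sym (T S : H -> H) : is_adjoint T S -> is_adjoint S T.
Proof. by move=> TS x y; rewrite inner_conj -TS -inner_conj. Qed.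

Lemma is_adjointD (T S T' S' : H -> H) : is_adjoint T S -> is_adjoint T' S' ->
  is_adjoint (fun x => T x + T' x) (fun x => S x + S' x).
Proof. by move=> TS TS' x y; rewrite innerDl innerDr TS TS'. Qed.

Lemma is_adjointZ (c : R) (T S : H -> H) : is_adjoint T S ->
  is_adjoint (fun x => c%:C *: T x) (fun x => c%:C *: S x).
Proof.
move=> TS x y; rewrite innerZl innerZr TS; congr (_ * _).
by apply/eqP; rewrite eq_complex /= oppr0 !eqxx.
Qed.

Lemma is_adjoint_sum (n : nat) (T S : nat -> H -> H) :
  (forall i, is_adjoint (T i) (S i)) ->
  is_adjoint (fun x => \sum_(i < n) T i x) (fun x => \sum_(i < n) S i x).
Proof.
by move=> TS x y; rewrite inner_suml inner_sumr; apply: eq_bigr => i _; exact: TS.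
Qed.

End Inner.

(** * The sign algebra and its GNS space *)

Section SignAlgebra.
Variables (R : realType) (I : choiceType) (sg : I -> I -> R[i]).
Variable (A : sign_algebra sg).
Hypothesis sg_diag : forall u, sg u u = -1.
Implicit Types (s t : seq I).

Definition gen_prod s : A := \prod_(u <- s) sgen A u.

Lemma gen_prod_cons u s : gen_prod (u :: s) = sgen A u * gen_prod s.
Proof. by rewrite /gen_prod big_cons. Qed.

Lemma gen_prod_cat s t : gen_prod (s ++ t) = gen_prod s * gen_prod t.
Proof. by rewrite /gen_prod big_cat. Qed.

Lemma sgen_sqr u : sgen A u * sgen A u = 1.
Proof.
have := (sgenP A).2 u u; rewrite eqxx sg_diag scaleN1r opprK -mulr2n.
rewrite mulr1n => h; apply/eqP; rewrite -subr_eq0.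
have : (2%:R : R[i]) *: (sgen A u * sgen A u - 1) = 0.
  by rewrite scaler_nat mulrnBl h subrr.
by move/eqP; rewrite scaler_eq0 pnatr_eq0.
Qed.

Lemma sgenK u (a : A) : sgen A u * (sgen A u * a) = a.
Proof. by rewrite mulrA sgen_sqr mul1r. Qed.

Lemma sgen_swap u v : u != v -> sgen A v * sgen A u = sg v u *: (sgen A u * sgen A v).
Proof.
move=> uv; apply/eqP; rewrite -subr_eq0 (sgenP A).2.
by rewrite [v == u]eq_sym (negbTE uv).
Qed.

Lemma gen_prod_front s1 s2 u : u \notin s1 ->
  gen_prod (s1 ++ u :: s2) = \prod_(v <- s1) sg v u *: gen_prod (u :: s1 ++ s2).
Proof.
elim: s1 => [|v s1 IH] /=; first by rewrite big_nil scale1r.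
rewrite inE negb_or => /andP[uv us1].
rewrite gen_prod_cons IH // big_cons !gen_prod_cons -scalerAr !mulrA (sgen_swap uv).
by rewrite -!scalerAl scalerA mulrC.
Qed.

Lemma gen_prod_rem u s : u \in s -> exists c, gen_prod s = c *: gen_prod (u :: rem u s).
Proof.
elim: s => [//|v s IH] /=; case: eqVneq => [<- _|vu]; first by exists 1; rewrite scale1r.
rewrite inE eq_sym (negbTE vu) /= => /IH[c cE]; exists (c * sg v u).
rewrite gen_prod_cons cE !gen_prod_cons -scalerAr !mulrA.
by rewrite (@sgen_swap u v) 1?eq_sym // -!scalerAl scalerA.
Qed.

(** Reordering costs only a product of entries of [sg]; linear arguments do not depend on its
    value. *)
Lemma gen_prod_perm s t : perm_eq s t -> exists c, gen_prod s = c *: gen_prod t.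
Proof.
rewrite perm_sym; elim: t s => [|u t IH] s.
  by rewrite perm_sym => /perm_nilP ->; exists 1; rewrite scale1r.
move=> ts; have us : u \in s by rewrite -(perm_mem ts) mem_head.
have [c ->] := gen_prod_rem us.
have [|c' c'E] := IH (rem u s).
  by rewrite -(perm_cons u) (perm_trans ts) // perm_to_rem.
by exists (c * c'); rewrite !gen_prod_cons c'E -scalerAr scalerA.
Qed.

(** Equal generators can be brought together and square to 1, so only the parity of each
    multiplicity matters. *)
Lemma gen_prod_reduce s : exists c t,
  [/\ uniq t, forall u, (u \in t) = odd (count_mem u s) & gen_prod s = c *: gen_prod t].
Proof.
elim: s => [|u s [c [t [ut tE sE]]]]; first by exists 1, [::]; rewrite scale1r.
have [uint|unt] := boolP (u \in t); last first.
  exists c, (u :: t); split; first by rewrite /= unt.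
    move=> v; rewrite inE /= oddD -tE eq_sym.
    by case: eqVneq => [<-|_]; rewrite ?(negbTE unt).
  by rewrite !gen_prod_cons sE -scalerAr.
have [c' c'E] := gen_prod_rem uint.
exists (c * c'), (rem u t); split; first exact: rem_uniq.
  move=> v; rewrite mem_rem_uniq // inE /= oddD -tE eq_sym.
  by case: eqVneq => [<-|_]; rewrite ?uint.
by rewrite gen_prod_cons sE c'E gen_prod_cons -!scalerAr sgenK scalerA.
Qed.

Lemma sstar1 : sstar (1 : A) = 1.
Proof.
have [_ sM sK] := sstarP A.
by have := sM (sstar 1) 1; rewrite mulr1 sK mulr1 => <-.
Qed.

Lemma sstar_gen_prod s : sstar (gen_prod s) = gen_prod (rev s).
Proof.
have [_ sM _] := sstarP A.
elim: s => [|u s IH]; first by rewrite /gen_prod !big_nil sstar1.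
rewrite gen_prod_cons sM (sgenP A).1 IH rev_cons -cats1 gen_prod_cat.
by rewrite gen_prod_cons {3}/gen_prod big_nil mulr1.
Qed.

(* The intermediate predicate quantifies over [Q], which is then instantiated
   with preimages of [Q] under left multiplication to handle products. *)
Lemma gen_prod_ind (Q : set A) :
  (forall (c : R[i]) a b, Q a -> Q b -> Q (c *: a + b)) ->
  (forall s, Q (gen_prod s)) -> forall a, Q a.
Proof.
pose S (a : A) := forall Q : set A,
  (forall (c : R[i]) x y, Q x -> Q y -> Q (c *: x + y)) ->
  (forall s, Q (gen_prod s)) -> forall s, Q (a * gen_prod s).
have [sL sM sK] := sstarP A.
(* Generation includes closure under the star, so the property is carried for [a] and [sstar a]
   together. *)
move=> Ql Qs a; suff [Sa _] : S a /\ S (sstar a).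
  by have := Sa Q Ql Qs [::]; rewrite /gen_prod big_nil mulr1.
have Sgen u : S (sgen A u) by move=> Q' Q'l Q's s; rewrite -gen_prod_cons.
have S1 : S 1 by move=> Q' Q'l Q's s; rewrite mul1r.
have SL c x y : S x -> S y -> S (c *: x + y).
  move=> Sx Sy Q' Q'l Q's s; rewrite mulrDl -scalerAl.
  exact: Q'l (Sx Q' Q'l Q's s) (Sy Q' Q'l Q's s).
have SM x y : S x -> S y -> S (x * y).
  move=> Sx Sy Q' Q'l Q's s; rewrite -mulrA.
  apply: (Sy [set z | Q' (x * z)]) => [c y1 y2 /= h1 h2|s' /=].
    by rewrite mulrDr -scalerAr; exact: Q'l.
  exact: (Sx Q' Q'l Q's s').
move: a; apply: (sgen_generates (S := [set a | S a /\ S (sstar a)])).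
- by move=> u /=; rewrite (sgenP A).1.
- by rewrite /= sstar1.
- by move=> c x y /= [Sx Sx'] [Sy Sy']; rewrite sL; split; exact: SL.
- by move=> x y /= [Sx Sx'] [Sy Sy']; rewrite sM; split; exact: SM.
- by move=> x /= [Sx Sx']; rewrite sK.
Qed.

End SignAlgebra.

(** * Creation and annihilation on products of generators *)

Section SignVectors.
Variables (R : realType) (I : choiceType) (r : rel I) (sg : I -> I -> R[i]).
Variable (M : sign_space r sg).
Hypothesis sg_diag : forall u, sg u u = -1.
Implicit Types (s t : seq I).

(** The value 0 on lists with repetitions makes [gcre M u] act on every list by adding [u] in front,
    see [gcre_ket]. *)
Definition ket s : M := if uniq s then gincl M (gen_prod (galg M) s) else 0.

Lemma ket_uniq s : uniq s -> ket s = gincl M (gen_prod (galg M) s).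
Proof. by rewrite /ket => ->. Qed.

Lemma ket_nuniq s : ~~ uniq s -> ket s = 0.
Proof. by rewrite /ket => /negbTE ->. Qed.

Lemma perm_sort_fset s : uniq s -> perm_eq s (sort r [fset u in s]%fset).
Proof.
move=> us; rewrite perm_sym perm_sort; apply: uniq_perm => // u.
by rewrite inE.
Qed.

Lemma gphi_gen_prod s : uniq s -> s != [::] -> gphi M (gen_prod (galg M) s) = 0.
Proof.
move=> us s0; have [c ->] := gen_prod_perm (galg M) (perm_sort_fset us).
rewrite linearZ /= -/(monomial _ _ _) gphiE.
case: s us s0 => [//|u s] _ _; have -> : [fset v in u :: s]%fset == fset0 = false.
  by apply/negbTE/fset0Pn; exists u; rewrite !inE eqxx.
by rewrite scaler0.
Qed.

Lemma gphi1 : gphi M 1 = 1.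
Proof.
have -> : (1 : galg M) = monomial (galg M) r fset0.
  rewrite /monomial; suff -> : sort r (fset0 : {fset I}) = [::] by rewrite big_nil.
  by apply/nilP; rewrite /nilp size_sort cardfs0.
by rewrite gphiE eqxx.
Qed.

Lemma inner_ket s t : uniq s -> uniq t ->
  inner (ket s) (ket t) = gphi M (gen_prod (galg M) (rev s ++ t)).
Proof.
by move=> us ut; rewrite !ket_uniq // gincl_inner sstar_gen_prod gen_prod_cat.
Qed.

(** For duplicate-free lists, [u] has odd multiplicity in [rev s ++ t], so it survives the reduction
    and [gphi] vanishes. *)
Lemma inner_ket_eq0 s t u : (u \in s) != (u \in t) -> inner (ket s) (ket t) = 0.
Proof.
have [us|us] := boolP (uniq s); last by rewrite ket_nuniq ?inner0l.
have [ut|ut] := boolP (uniq t); last by rewrite (ket_nuniq ut) inner0r.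
move=> ust; rewrite inner_ket //.
have [c [w [uw wE ->]]] := gen_prod_reduce (galg M) sg_diag (rev s ++ t).
rewrite linearZ /= gphi_gen_prod ?scaler0 //; apply/eqP => w0.
move: (wE u); rewrite w0 in_nil count_cat oddD count_rev !count_uniq_mem //.
by move: ust; do 2!case: (u \in _).
Qed.

Lemma inner_ket_cons u s t : uniq (u :: s) -> uniq (u :: t) ->
  inner (ket (u :: s)) (ket (u :: t)) = inner (ket s) (ket t).
Proof.
move=> us ut; rewrite !inner_ket //; [|by case/andP: us|by case/andP: ut].
rewrite rev_cons cat_rcons !gen_prod_cat !gen_prod_cons.
by rewrite [sgen _ u * _]mulrA sgen_sqr // mul1r.
Qed.

Lemma ket_dense (x x' : M) :
  (forall s, uniq s -> inner (ket s) x = inner (ket s) x') -> x = x'.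
Proof.
move=> h; apply: eq_inner_dense (@gincl_dense _ _ _ _ M) _ => _ [a _ <-].
move: a; apply: gen_prod_ind => [c a b ea eb|s].
  by rewrite linearP /= !innerDl !innerZl ea eb.
have [c [t [ut _ ->]]] := gen_prod_reduce (galg M) sg_diag s.
by rewrite linearZ /= !innerZl -ket_uniq // h.
Qed.

(** Creation is specified on sorted monomials; reordering costs the same scalar on both sides. *)
Lemma gcre_ket u s : gcre M u (ket s) = ket (u :: s).
Proof.
have [us|us] := boolP (uniq s); last first.
  by rewrite ket_nuniq // linear0 ket_nuniq //= (negbTE us) andbF.
rewrite ket_uniq //; have [c cE] := gen_prod_perm (galg M) (perm_sort_fset us).
rewrite cE !linearZ /= -/(monomial _ _ _) gcreE inE /=.
have [us'|us'] := ifPn; first by rewrite scaler0 ket_nuniq //= us'.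
by rewrite ket_uniq /= ?us' // gen_prod_cons cE -scalerAr linearZ.
Qed.

Lemma inner_gann u (x y : M) : inner x (gann M u y) = inner (gcre M u x) y.
Proof. by rewrite inner_conj gannE -inner_conj. Qed.

Lemma gann_ket_notin u t : u \notin t -> gann M u (ket t) = 0.
Proof.
move=> ut; apply: ket_dense => s us; rewrite inner0r inner_gann gcre_ket.
by rewrite (@inner_ket_eq0 _ _ u) // mem_head (negbTE ut).
Qed.

(** Tested against [ket M s]: if [u] is in [s], both sides vanish; otherwise the two leading copies
    of [u] cancel. *)
Lemma gann_ket_cons u t : u \notin t -> gann M u (ket (u :: t)) = ket t.
Proof.
move=> ut; apply: ket_dense => s us; rewrite inner_gann gcre_ket.
have [tu|tu] := boolP (uniq t); last first.
  by rewrite (@ket_nuniq (u :: t)) ?(ket_nuniq tu) ?inner0r //= (negbTE tu) andbF.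
have [uins|unins] := boolP (u \in s).
  by rewrite ket_nuniq /= ?uins // inner0l (@inner_ket_eq0 _ _ u) // uins (negbTE ut).
by rewrite inner_ket_cons //= ?unins ?ut.
Qed.

(** At most one index contributes, and bringing [u] to the front costs the product of [sg v u]. The
    sum is kept for its likeness to [fann_tensor_ket]. *)
Lemma gann_ket u (t : seq I) : uniq t -> gann M u (ket t) =
  \sum_(l < size t) (if nth u t l == u then \prod_(v <- take l t) sg v u else 0)
     *: ket (omit l t).
Proof.
move=> ut; have [uint|unt] := boolP (u \in t); last first.
  rewrite gann_ket_notin // big1 // => l _ /=.
  case: eqP => [lu|_]; last by rewrite scale0r.
  by case/negP: unt; rewrite -lu mem_nth.
have lt : (index u t < size t)%N by rewrite index_mem.
rewrite (bigD1 (Ordinal lt)) //= nth_index // eqxx [X in _ + X]big1 ?addr0; last first.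
  move=> l /eqP; case: (nth u t l =P u) => [lu []|_ _]; last by rewrite scale0r.
  by apply: val_inj => /=; rewrite -[in RHS]lu index_uniq.
have tE : t = take (index u t) t ++ u :: drop (index u t).+1 t.
  by rewrite -[LHS](cat_take_drop (index u t)) (drop_nth u lt) nth_index.
have uomit : u \notin omit (index u t) t.
  by move: ut; rewrite {1}tE -cat1s uniq_catCA /= => /andP[].
have ut1 : u \notin take (index u t) t.
  by move: uomit; rewrite /omit mem_cat negb_or => /andP[].
have uo : uniq (u :: omit (index u t) t).
  by move: ut; rewrite {1}tE -cat1s uniq_catCA.
rewrite -(gann_ket_cons uomit) -linearZ /=; congr (gann _ _ _).
by rewrite !ket_uniq // -linearZ -gen_prod_front // -tE.
Qed.

Lemma inner_vac_ket s : inner (gvac M) (ket s) = (s == [::])%:R.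
Proof.
have vacE : gvac M = ket [::] by rewrite ket_uniq // /gen_prod big_nil.
case: s => [|u s]; last by rewrite vacE (@inner_ket_eq0 _ _ u) // mem_head.
by rewrite vacE inner_ket // /gen_prod big_nil gphi1.
Qed.

End SignVectors.

(** * Words of operators evaluated in the sign model *)

Section SignWords.
Variables (R : realType) (k : nat) (r : rel (gen_index k)).
Variables (sg : gen_index k -> gen_index k -> R[i]) (M : sign_space r sg).
Variable sgR : nat -> nat -> R.
Hypothesis sgE : forall u v, sg u v = (sgR u.1 v.1)%:C.
Hypothesis sgR_diag : forall a, sgR a a = -1.
Hypothesis sgR_sym : forall a b, sgR a b = sgR b a.

Let C := signed_index k.

Definition letter_op n (L : letter R C) (x : M) : M :=
  (Num.sqrt n%:R)^-1%:C *:
    \sum_(a < n) ((lcre L)%:C *: gcre M (nat_of_ord a, lup L) x +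
                  (lann L)%:C *: gann M (nat_of_ord a, ldown L) x).

Definition dual_letter (L : letter R C) := Letter (lann L) (ldown L) (lcre L) (lup L).

Lemma letter_op_adjoint n L : is_adjoint (letter_op n L) (letter_op n (dual_letter L)).
Proof.
apply: is_adjointZ.
pose F L' a (x : M) := (lcre L')%:C *: gcre M (a, lup L') x +
                       (lann L')%:C *: gann M (a, ldown L') x.
apply: (@is_adjoint_sum _ _ n (F L) (F (dual_letter L))) => a x y.
rewrite /F /= [X in inner X y]addrC.
apply: (@is_adjointD _ _ (fun x => (lcre L)%:C *: gcre M (a, lup L) x)
  (fun x => (lcre L)%:C *: gann M (a, lup L) x)
  (fun x => (lann L)%:C *: gann M (a, ldown L) x)
  (fun x => (lann L)%:C *: gcre M (a, ldown L) x)); apply: is_adjointZ.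
  exact: gannE.
exact/is_adjoint_sym/gannE.
Qed.

Definition word_op n (W : seq (letter R C)) (x : M) : M :=
  foldl (fun y L => letter_op n L y) x W.

(** Moving the letters to the left as adjoints turns the expectation of a word into a functional
    [inner psi], whose linearity lets the induction peel off the letter acting first. *)
Lemma word_op_vector n W : exists psi : M,
  forall x, inner (gvac M) (word_op n W x) = inner psi x.
Proof.
elim: W => [|L W [psi psiE]]; first by exists (gvac M).
exists (letter_op n (dual_letter L) psi) => x /=.
by rewrite psiE -letter_op_adjoint.
Qed.

Let sg_diag u : sg u u = -1.
Proof. by rewrite sgE sgR_diag rmorphN1. Qed.

Lemma sum_gann_ket n (c : signed_index k) (s : seq (gen_index k))
    (psi : M) (f : seq (gen_index k) -> R) :
  uniq s -> (forall t, inner psi (ket M t) = (f t)%:C) ->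
  \sum_(a < n) inner psi (gann M (nat_of_ord a, c) (ket M s)) =
  (\sum_(l < size s) annihilate sgR n c s l * f (omit l s))%:C.
Proof.
move=> us psif; under eq_bigr do rewrite gann_ket // inner_sumr.
rewrite exchange_big rmorph_sum; apply: eq_bigr => l _ /=.
under eq_bigr do rewrite innerZr psif.
rewrite -mulr_suml rmorphM; congr (_ * _).
rewrite /annihilate; set v := nth (0%N, c) s l.
transitivity (\sum_(a < n)
    (if v == (nat_of_ord a, c) then \prod_(w <- take l s) sg w (nat_of_ord a, c) else 0)).
  apply: eq_bigr => a _; congr (if _ == _ then _ else _).
  (* The defaults of the two [nth] differ, but [l] is in range. *)
  exact: set_nth_default.
case: ifP => [/andP[/eqP vc vn]|cond].
  rewrite (bigD1 (Ordinal vn)) //= [X in _ + X]big1 ?addr0 => [|a av].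
    case: eqP => [_|[]]; last by rewrite -vc; case: (v).
    rewrite rmorph_prod; apply: eq_bigr => w _.
    by rewrite sgE sgR_sym.
  case: eqP => // va; case/eqP: av; apply: val_inj => /=.
  by rewrite va.
rewrite big1 // => a _; case: eqP => // va.
by move: cond; rewrite va /= eqxx ltn_ord.
Qed.

Lemma inner_word_op n W s :
  inner (gvac M) (word_op n W (ket M s)) = (sign_value sgR n W s)%:C.
Proof.
elim: W s => [|L W IH] s /=.
  by rewrite inner_vac_ket // rmorph_nat.
have [psi psiE] := word_op_vector n W.
have psif t : inner psi (ket M t) = (sign_value sgR n W t)%:C by rewrite -psiE IH.
rewrite psiE /letter_op innerZr inner_sumr.
have opE (a : 'I_n) : true ->
    inner psi ((lcre L)%:C *: gcre M (nat_of_ord a, lup L) (ket M s) +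
               (lann L)%:C *: gann M (nat_of_ord a, ldown L) (ket M s)) =
    (lcre L * sign_value sgR n W ((nat_of_ord a, lup L) :: s))%:C +
    (lann L)%:C * inner psi (gann M (nat_of_ord a, ldown L) (ket M s)).
  by move=> _; rewrite innerDr !innerZr gcre_ket // psif rmorphM.
transitivity ((Num.sqrt n%:R)^-1%:C * \sum_(a < n)
    ((lcre L * sign_value sgR n W ((nat_of_ord a, lup L) :: s))%:C +
     (lann L)%:C * inner psi (gann M (nat_of_ord a, ldown L) (ket M s)))).
  by congr (_ * _); apply: eq_bigr => a; exact: opE.
rewrite big_split -mulr_sumr -rmorph_sum -mulr_sumr mulrDr !rmorphD !rmorphM /=.
rewrite mulrCA; congr (_ + _); rewrite mulrCA; congr (_ * (_ * _)).
have [us|us] := ifPn; last first.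
  by rewrite big1 // => a _; rewrite ket_nuniq // linear0 inner0r.
by rewrite (sum_gann_ket n (ldown L) us psif).
Qed.

End SignWords.

(** * The q-Fock space *)

Section Inversions.

Lemma inversions_sum n (s : 'S_n) :
  inversions s = (\sum_(i < n) \sum_(j < n) ((i < j) && (s j < s i)))%N.
Proof.
rewrite /inversions -sum1_card pair_big /= big_mkcond /=.
by apply: eq_bigr => ij _; case: ifP; rewrite inE => ->.
Qed.

Lemma sum_lift_lt n (l : 'I_n.+1) : (\sum_(j < n) (lift l j < l) = l)%N.
Proof.
rewrite (eq_bigr (fun j : 'I_n => nat_of_bool (j < l)%N)); last first.
  by move=> j _ /=; rewrite /bump; case: (leqP l j) => h; lia.
rewrite -(big_mkord xpredT (fun j => nat_of_bool (j < l)%N)).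
rewrite -big_mkcond sum1_count /index_iota.
have -> : iota 0 (n - 0) = iota 0 l ++ iota l (n - l).
  by rewrite subn0 -{1}(subnKC (ltn_ord l : (l <= n)%N)) iotaD.
rewrite count_cat (eq_in_count (a2 := xpredT)) ?count_predT ?size_iota; last first.
  by move=> j; rewrite mem_iota.
rewrite (eq_in_count (a2 := xpred0)) ?count_pred0 ?addn0 // => j.
by rewrite mem_iota => /andP[h _] /=; rewrite ltnNge h.
Qed.

(** The position [ord0] takes the value [l], so it is inverted with the [l] positions of smaller
    value; the other pairs keep their order. *)
Lemma inversions_lift n (l : 'I_n.+1) (s : 'S_n) :
  inversions (lift_perm ord0 l s) = (l + inversions s)%N.
Proof.
rewrite !inversions_sum big_ord_recl /=; congr (_ + _)%N.
  rewrite big_ord_recl ltnn add0n -[RHS]sum_lift_lt [RHS](reindex_inj (@perm_inj _ s)) /=.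
  by apply: eq_bigr => j _; rewrite lift_perm_id lift_perm_lift.
apply: eq_bigr => i _; rewrite big_ord_recl /= add0n; apply: eq_bigr => j _.
rewrite !lift_perm_lift /= /bump !leq0n !add1n ltnS.
by congr (_ && _); case: leqP; case: leqP; lia.
Qed.

Lemma lift_perm0_bij n :
  bijective (fun ls : 'I_n.+1 * 'S_n => lift_perm ord0 ls.1 ls.2).
Proof.
apply: inj_card_bij; last by rewrite card_prod !card_Sn card_ord factS.
move=> [l s] [l' s'] /= e.
have ll : l = l' by have := congr1 (fun t : 'S_n.+1 => t ord0) e; rewrite !lift_perm_id.
rewrite -ll in e *; congr pair; apply/permP => i; apply: (@lift_inj _ l).
by have := congr1 (fun t : 'S_n.+1 => t (lift ord0 i)) e; rewrite !lift_perm_lift.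
Qed.

(** Expansion of a q-permanent along its first row; [q ^+ l] accounts for the inversions created by
    choosing column [l]. *)
Lemma sum_inversions_expand (S : comNzRingType) (q : S) n (a : 'I_n.+1 -> 'I_n.+1 -> S) :
  \sum_(s : 'S_n.+1) q ^+ inversions s * \prod_i a i (s i) =
  \sum_l a ord0 l * q ^+ l *
    \sum_(s : 'S_n) q ^+ inversions s * \prod_i a (lift ord0 i) (lift l (s i)).
Proof.
rewrite (reindex _ (onW_bij _ (lift_perm0_bij n))) /=.
under [RHS]eq_bigr do rewrite mulr_sumr.
rewrite pair_bigA /=; apply: eq_bigr => -[l s] _ /=.
have -> : \prod_i a i (lift_perm ord0 l s i) =
          a ord0 l * \prod_i a (lift ord0 i) (lift l (s i)).
  rewrite big_ord_recl lift_perm_id; congr (_ * _).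
  by apply: eq_bigr => i _; rewrite lift_perm_lift.
by rewrite inversions_lift exprD; ring.
Qed.

End Inversions.

(** * Creation and annihilation on tensors of basis vectors *)

Section FockVectors.
Variables (R : realType) (q : R) (k : nat) (F : qfock_space q k).
Let C := ('I_k * bool)%type.
Implicit Types (c : C) (g h : seq C).

Definition tensor_ket g : F :=
  fincl F (size g) (elementary_tensor [tuple of map (@basis_vector R k) (in_tuple g)]).

Lemma inner_basis_vector c c' :
  one_particle_inner (basis_vector R c) (basis_vector R c') = (c == c')%:R.
Proof.
rewrite /one_particle_inner (bigD1 c) //= big1 ?addr0 => [|c'' cc].
  by rewrite !ffunE eqxx conjC1 mul1r.
by rewrite !ffunE (negbTE cc) conjC0 mul0r.
Qed.

Lemma inner_tensor_ket_neq g h : size g != size h ->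
  inner (tensor_ket g) (tensor_ket h) = 0.
Proof. exact: fincl_orthogonal. Qed.

Lemma tensor_ketE n (g : n.-tuple C) :
  tensor_ket g = fincl F n (elementary_tensor [tuple of map (@basis_vector R k) g]).
Proof.
case: g => g gn /=; have e : size g = n by exact/eqP.
subst n; rewrite /tensor_ket; congr (fincl F _ (elementary_tensor _)).
exact: val_inj.
Qed.

Lemma inner_tensor_ket c0 n g h : size g = n -> size h = n ->
  inner (tensor_ket g) (tensor_ket h) =
  \sum_(s : 'S_n) (q%:C) ^+ inversions s *
    \prod_(i < n) (nth c0 g i == nth c0 h (s i))%:R.
Proof.
move=> /eqP gn /eqP hn; rewrite (tensor_ketE (Tuple gn)) (tensor_ketE (Tuple hn)).
rewrite fincl_inner; apply: eq_bigr => s _; rewrite rmorphXn; congr (_ * _).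
by apply: eq_bigr => i _; rewrite !tnth_map inner_basis_vector !(tnth_nth c0).
Qed.

Lemma fcre_tensor_ket c g :
  fcre F (basis_vector R c) (tensor_ket g) = tensor_ket (c :: g).
Proof.
rewrite /tensor_ket fcreE; congr (fincl F _ (elementary_tensor _)).
exact: val_inj.
Qed.

Lemma nth_omit (T : Type) (x0 : T) l (s : seq T) j :
  (l < size s)%N -> nth x0 (omit l s) j = nth x0 s (bump l j).
Proof.
move=> ls; rewrite /omit nth_cat size_take ls /bump.
case: (ltnP j l) => jl; first by rewrite nth_take // add0n.
by rewrite nth_drop; congr nth; lia.
Qed.

(** Tensors of basis vectors span each tensor power, and finite sums over the tensor powers are
    dense. *)
Lemma tensor_ket_dense (x x' : F) :
  (forall g, inner (tensor_ket g) x = inner (tensor_ket g) x') -> x = x'.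
Proof.
move=> h; apply: eq_inner_dense (@fincl_dense _ _ _ F) _ => _ [N [t ->]].
rewrite !inner_suml; apply: eq_bigr => n _.
have -> : t n = \sum_(w : n.-tuple C) t n w *:
    elementary_tensor [tuple of map (@basis_vector R k) w].
  apply/ffunP => w; rewrite sum_ffunE (bigD1 w) //= big1 ?addr0 => [|w' ww'].
    rewrite !ffunE big1 => [|i _]; first exact/esym/mulr1.
    by rewrite tnth_map ffunE eqxx.
  rewrite !ffunE; have [i wi] : exists i, tnth w i != tnth w' i.
    apply/existsP; apply: contraR ww'; rewrite negb_exists => /forallP ww'.
    by apply/eqP/eq_from_tnth => i; have := ww' i; rewrite negbK => /eqP.
  by rewrite (bigD1 i) //= tnth_map ffunE (negbTE wi) mul0r scaler0.
rewrite linear_sum /= !inner_suml; apply: eq_bigr => w _.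
by rewrite linearZ /= !innerZl -tensor_ketE h.
Qed.

Lemma inner_fann c (x y : F) : inner x (fann F (basis_vector R c) y) =
  inner (fcre F (basis_vector R c) x) y.
Proof. by rewrite inner_conj fannE -inner_conj. Qed.

(** Pairing with [tensor_ket h] gives a q-permanent whose first row comes from [c]; its expansion
    has one term per removed position. *)
Lemma fann_tensor_ket c g : fann F (basis_vector R c) (tensor_ket g) =
  \sum_(l < size g) (if nth c g l == c then q ^+ l else 0)%:C *: tensor_ket (omit l g).
Proof.
apply: tensor_ket_dense => h; rewrite inner_fann fcre_tensor_ket inner_sumr.
have [ghE|gh] := eqVneq (size g) (size h).+1; last first.
  rewrite inner_tensor_ket_neq 1?eq_sym // big1 // => l _.
  rewrite innerZr inner_tensor_ket_neq ?mulr0 // size_omit //.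
  by apply: contra gh => /eqP ->; rewrite prednK // (leq_trans _ (ltn_ord l)).
rewrite (@inner_tensor_ket c (size h).+1 (c :: h) g) //.
rewrite (@sum_inversions_expand _ q%:C (size h) (fun i j =>
  (nth c (c :: h) i == nth c g j)%:R)) ghE; apply: eq_bigr => l _ /=.
have lg : (l < size g)%N by rewrite ghE.
rewrite innerZr (@inner_tensor_ket c (size h)) //; last by rewrite size_omit // ghE.
congr (_ * _).
  by rewrite eq_sym; case: eqP => _; rewrite ?mul1r ?mul0r ?rmorphXn.
apply: eq_bigr => s _; congr (_ * _); apply: eq_bigr => i _.
by rewrite nth_omit.
Qed.

Lemma inner_fvac_tensor_ket g : inner (fvac F) (tensor_ket g) = (g == [::])%:R.
Proof.
have vacE : fvac F = tensor_ket [::].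
  by rewrite /fvac /tensor_ket; congr (fincl F _ (elementary_tensor _)); exact: val_inj.
case: g => [|c g]; last by rewrite vacE inner_tensor_ket_neq.
rewrite vacE /tensor_ket fincl_inner (bigD1 1%g) //= big_ord0 mulr1.
rewrite big1 ?addr0 => [|s]; last by case/eqP; apply/permP => -[].
suff -> : inversions (1%g : 'S_0) = 0%N by rewrite expr0.
by rewrite inversions_sum big_ord0.
Qed.

Definition fock_letter_op (L : letter R C) (x : F) : F :=
  (lcre L)%:C *: fcre F (basis_vector R (lup L)) x +
  (lann L)%:C *: fann F (basis_vector R (ldown L)) x.

Lemma fock_letter_op_adjoint L :
  is_adjoint (fock_letter_op L) (fock_letter_op (dual_letter L)).
Proof.
move=> x y; rewrite /fock_letter_op /= [X in inner X y]addrC.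
apply: (@is_adjointD _ _ (fun x => (lcre L)%:C *: fcre F (basis_vector R (lup L)) x)
  (fun x => (lcre L)%:C *: fann F (basis_vector R (lup L)) x)
  (fun x => (lann L)%:C *: fann F (basis_vector R (ldown L)) x)
  (fun x => (lann L)%:C *: fcre F (basis_vector R (ldown L)) x)); apply: is_adjointZ.
  exact: fannE.
exact/is_adjoint_sym/fannE.
Qed.

Definition fock_word_op (W : seq (letter R C)) (x : F) : F :=
  foldl (fun y L => fock_letter_op L y) x W.

Lemma fock_word_op_vector W : exists psi : F,
  forall x, inner (fvac F) (fock_word_op W x) = inner psi x.
Proof.
elim: W => [|L W [psi psiE]]; first by exists (fvac F).
exists (fock_letter_op (dual_letter L) psi) => x /=.
by rewrite psiE -fock_letter_op_adjoint.
Qed.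

Lemma inner_fock_word_op W g :
  inner (fvac F) (fock_word_op W (tensor_ket g)) = (fock_value q W g)%:C.
Proof.
elim: W g => [|L W IH] g /=.
  by rewrite inner_fvac_tensor_ket rmorph_nat.
have [psi psiE] := fock_word_op_vector W.
have psif h : inner psi (tensor_ket h) = (fock_value q W h)%:C by rewrite -psiE IH.
rewrite psiE /fock_letter_op innerDr !innerZr fcre_tensor_ket psif.
rewrite fann_tensor_ket inner_sumr rmorphD !rmorphM rmorph_sum /=.
congr (_ + _ * _); apply: eq_bigr => l _; rewrite innerZr psif rmorphM.
congr (_%:C * _); congr (if _ == _ then _ else _); exact: set_nth_default.
Qed.

End FockVectors.

(** * The limit *)

Lemma cvg_real_complex (R : realType) (u : nat -> R) (l : R) :
  u @ \oo --> l -> (fun n => (u n)%:C : R[i]^o) @ \oo --> (l%:C : R[i]^o).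
Proof.
move=> ul; apply/cvgrPdist_lt => eps eps0.
have epsE : eps = (complex.Re eps)%:C.
  by move: eps0; case: eps => a b; rewrite ltcE /= => /andP[/eqP -> _].
have re0 : 0 < complex.Re eps by move: eps0; rewrite epsE ltcR.
move/cvgrPdist_lt : ul => /(_ _ re0); apply: filterS => n h.
by rewrite -rmorphB normc_def /= expr0n addr0 sqrtr_sqr epsE ltcR.
Qed.

(** In [op_prod] the last operator acts first, hence the reversal. *)
Lemma op_prod_foldl (H A : Type) (p : nat) (f : A -> H -> H) (L : 'I_p -> A) (x : H) :
  op_prod (fun m => f (L m)) x = foldl (fun y a => f a y) x (rev (map L (enum 'I_p))).
Proof.
rewrite foldl_rev /op_prod [index_enum _]unlock -enumT.
elim: (enum 'I_p) x => [|m s IH] x; first by rewrite big_nil.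
by rewrite big_cons /= IH.
Qed.

Section SignedLetters.
Variables (R : realType) (k : nat) (mu : 'I_k -> R).

(** For [e] true this is the letter of [s_op] and [c_op]; for [e] false it is the adjoint letter,
    with the two weights and the two indices exchanged. *)
Definition signed_letter (j : 'I_k) (e : bool) : letter R (signed_index k) :=
  Letter (if e then (mu j)^-1 else mu j) (j, e) (if e then mu j else (mu j)^-1) (j, ~~ e).

Lemma dual_signed_letter j : dual_letter (signed_letter j true) = signed_letter j false.
Proof. by []. Qed.

Lemma signed_power_s_op (r : rel (gen_index k)) (sg : gen_index k -> gen_index k -> R[i])
    (M : sign_space r sg) n j e :
  signed_power (s_op (M := M) mu n j) e = letter_op (M := M) n (signed_letter j e).
Proof.
case: e; first by [].
by rewrite /= -dual_signed_letter; apply/adjointP/letter_op_adjoint.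
Qed.

Lemma signed_power_c_op (q : R) (F : qfock_space q k) j e :
  signed_power (c_op (F := F) mu j) e = fock_letter_op (F := F) (signed_letter j e).
Proof.
have cE : c_op (F := F) mu j = fock_letter_op (F := F) (signed_letter j true).
  by apply/funext => x; rewrite /c_op addrC.
case: e => //=; rewrite cE -dual_signed_letter.
by apply/adjointP/fock_letter_op_adjoint.
Qed.

End SignedLetters.

Lemma indic_sign_sym d (T : measurableType d) (R : realType) (P : probability T R)
    (eps : nat -> nat -> {RV P >-> R}) w a b :
  indic_sign eps w a b = indic_sign eps w b a.
Proof. by rewrite /indic_sign /edge maxnC minnC eq_sym. Qed.

Theorem proposition5p5 (R : realType) (d : measure_display)
    (T : measurableType d) (P : probability T R)
    (q : R) (hq : -1 < q < 1) (k : nat) (hk : (1 <= k)%N)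
    (lambda : 'I_k -> R) (hlambda : forall j, 1 <= lambda j)
    (mu : 'I_k -> R) (hmu : forall j, mu j = lambda j `^ (1 / 4))
    (eps : nat -> nat -> {RV P >-> R}) (heps : random_signs q eps)
    (r : rel (gen_index k)) (hr : is_total_order r)
    (F : qfock_space q k)
    (p : nat) (hp : (1 <= p)%N) (j : 'I_p -> 'I_k) (e : 'I_p -> bool) :
  {ae P, forall w, forall M : sign_space r (sign_matrix eps w),
    (fun n : nat => vector_state (gvac M)
       (op_prod (fun m => signed_power (s_op (M := M) mu n (j m)) (e m))))
    @ \oo -->
    (vector_state (fvac F)
       (op_prod (fun m => signed_power (c_op (F := F) mu (j m)) (e m))) : R[i]^o)}.
Proof.
have q1 : `|q| <= 1 by case/andP: hq => q0 q1; rewrite ler_norml !ltW.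
pose W := rev [seq signed_letter mu (j m) (e m) | m <- enum 'I_p].
have fockE : vector_state (fvac F)
    (op_prod (fun m => signed_power (c_op (F := F) mu (j m)) (e m))) =
    (fock_value q W [::])%:C.
  rewrite -(inner_fock_word_op F W [::]) /vector_state.
  under [X in op_prod X]eq_fun do rewrite signed_power_c_op.
  rewrite (op_prod_foldl (fock_letter_op (F := F))
    (fun m => signed_letter mu (j m) (e m))).
  congr (inner _ (foldl _ _ _)).
  by rewrite /fvac /tensor_ket; congr (fincl F _ (elementary_tensor _)); exact: val_inj.
rewrite fockE.
have := ae_four_cycles_cvg heps hq; have := ae_indic_sign heps.
(* The almost sure event involves only the signs, so one null set serves all spaces [M]. *)
apply: filterS2 => w epsE /four_cycles_cvg cyc M.
have sgE (u v : gen_index k) : sign_matrix eps w u v = (indic_sign eps w u.1 v.1)%:C.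
  rewrite /sign_matrix; case: eqVneq => [->|uv]; last by rewrite epsE.
  by rewrite /indic_sign eqxx rmorphN1.
have diag a : indic_sign eps w a a = -1 by rewrite /indic_sign eqxx.
have signE n : vector_state (gvac M)
    (op_prod (fun m => signed_power (s_op (M := M) mu n (j m)) (e m))) =
    (sign_value (indic_sign eps w) n W [::])%:C.
  rewrite -(inner_word_op M sgE diag (indic_sign_sym eps w)) /vector_state.
  under [X in op_prod X]eq_fun do rewrite signed_power_s_op.
  rewrite (op_prod_foldl (letter_op (M := M) n)
    (fun m => signed_letter mu (j m) (e m))).
  by congr (inner _ (foldl _ _ _)); rewrite ket_uniq // /gen_prod big_nil.
under eq_fun do rewrite signE.
apply: cvg_real_complex.
(* Here [delta n] is the fourth root of [four_cycles / n^4], and for the empty list the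
   normalisation is 1. *)
have := cvg_sign_value q1 (indic_sign_le1 eps w)
  (four_cycles_flat q (indic_sign eps w)) cyc (W := W) (g := [::]).
by rewrite /scaled_value /=; under eq_fun do rewrite expr0 divr1.
Qed.
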